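(* Let $d\in\mathbb{N}$. Suppose that $\{T_n\}_{n\ge 1}$ is a family of finite groups such that each $T_n$ is generated by the images of $d$ homomorphisms from the alternating group $\mathrm{Alt}(n)$ to $T_n$. Then the Cartesian product $\prod_{n=1}^\infty T_n$ is (isomorphic to) the profinite completion of a finitely generated group.
   Context: $\mathrm{Alt}(n)$ is the alternating group on $n$ letters. A Cartesian product of finite groups is regarded as a profinite group with the product topology. The profinite completion of a group $G$ is the inverse limit $\widehat{G}$ of all finite quotients of $G$. *)

(* Defs.v *)
From HB Require Import structures.
From mathcomp Require Import all_boot all_order all_algebra.
From mathcomp Require Import all_classical reals topology.
From mathcomp Require Import generic_quotient.

Set Implicit Arguments.
Unset Strict Implicit.
Unset Printing Implicit Defensive.

Local Open Scope classical_set_scope.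
Local Open Scope quotient_scope.
Local Open Scope group_scope.

Section Subgroups.
Variable G : groupType.
Implicit Types (H N S : set G) (x y : G).

Definition is_subgroup H : Prop :=
  [/\ H 1, forall x y, H x -> H y -> H (x * y) & forall x, H x -> H x^-1].

Definition is_normal N : Prop := forall x y, N x -> N (x ^ y).

Definition left_coset N x : set G := [set x * y | y in N].

Definition finite_index N : Prop := finite_set (range (left_coset N)).

Definition finitely_generated : Prop :=
  exists2 S, finite_set S & smallest is_subgroup S = [set: G].

Record fin_normal := FinNormal {
  fin_normal_set :> set G;
  fin_normal_subgroup : is_subgroup fin_normal_set;
  fin_normal_normal : is_normal fin_normal_set;
  fin_normal_index : finite_index fin_normal_set }.

End Subgroups.

Arguments finitely_generated G : clear implicits.
Arguments fin_normal G : clear implicits.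

Section Quotient.
Variables (G : groupType) (N : fin_normal G).
Implicit Types x y : G.

Definition coset_equiv x y : bool := x^-1 * y \in (N : set G).

Lemma coset_equiv_class : equiv_class_of coset_equiv.
Proof.
have [N1 NM NV] := fin_normal_subgroup N.
have sym x y : coset_equiv x y -> coset_equiv y x.
  by rewrite /coset_equiv !inE => /NV; rewrite invgM invgK.
split=> [x|x y|y x z]; first by rewrite /coset_equiv inE mulVg.
- by apply/idP/idP; exact: sym.
- rewrite /coset_equiv !inE => xy yz.
  by have := NM _ _ xy yz; rewrite mulgA mulgK.
Qed.

Canonical coset_equiv_rel := EquivRelPack coset_equiv_class.

Definition quot : Type := {eq_quot coset_equiv_rel}.

HB.instance Definition _ := Choice.on quot.
HB.instance Definition _ := EqQuotient.on quot.

Lemma quot_eqP x y : \pi_quot x = \pi_quot y <-> (N : set G) (x^-1 * y).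
Proof.
split=> [/eqP|Nxy]; last apply/eqP.
  by rewrite eqmodE /= /coset_equiv inE.
by rewrite eqmodE /= /coset_equiv inE.
Qed.

Definition quot_one : quot := \pi_quot 1.
Definition quot_mul (a b : quot) : quot := \pi_quot (repr a * repr b).
Definition quot_inv (a : quot) : quot := \pi_quot (repr a)^-1.

Lemma quot_reprP x : (N : set G) (x^-1 * repr (\pi_quot x)).
Proof. by apply/quot_eqP; rewrite reprK. Qed.

Lemma quot_piM x y : quot_mul (\pi_quot x) (\pi_quot y) = \pi_quot (x * y).
Proof.
have [_ NM _] := fin_normal_subgroup N.
apply/esym/quot_eqP; rewrite invgM.
have := NM _ _ (fin_normal_normal (repr (\pi_quot y)) (quot_reprP x)) (quot_reprP y).
have := NM _ _ (fin_normal_normal y (quot_reprP x)) (quot_reprP y).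
by rewrite /conjg !mulgA mulgK.
Qed.

Lemma quot_piV x : quot_inv (\pi_quot x) = \pi_quot x^-1.
Proof.
apply/quot_eqP; rewrite invgK.
have := fin_normal_normal x^-1 (quot_reprP x).
by rewrite /conjg invgK !mulgA mulgV mul1g.
Qed.

Lemma quot_elim (P : quot -> Prop) : (forall x, P (\pi_quot x)) -> forall a, P a.
Proof. by move=> Ppi a; rewrite -[a]reprK. Qed.

Lemma quot_mulA : associative quot_mul.
Proof.
move=> a b c; elim/quot_elim: a => x; elim/quot_elim: b => y.
by elim/quot_elim: c => z; rewrite !quot_piM mulgA.
Qed.

Lemma quot_mul1g : left_id quot_one quot_mul.
Proof. by move=> a; elim/quot_elim: a => x; rewrite quot_piM mul1g. Qed.

Lemma quot_mulg1 : right_id quot_one quot_mul.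
Proof. by move=> a; elim/quot_elim: a => x; rewrite quot_piM mulg1. Qed.

Lemma quot_mulVg : left_inverse quot_one quot_inv quot_mul.
Proof. by move=> a; elim/quot_elim: a => x; rewrite quot_piV quot_piM mulVg. Qed.

Lemma quot_mulgV : right_inverse quot_one quot_inv quot_mul.
Proof. by move=> a; elim/quot_elim: a => x; rewrite quot_piV quot_piM mulgV. Qed.

HB.instance Definition _ := isGroup.Build quot
  quot_mulA quot_mul1g quot_mulg1 quot_mulVg quot_mulgV.

End Quotient.

(* The Cartesian product of a family of discrete groups, with pointwise
   operations and the product topology. *)
Section Product.
Variables (I : Type) (T : I -> groupType).

Definition cartesian_prod : Type := forall i, T i.

HB.instance Definition _ := Choice.on cartesian_prod.
HB.instance Definition _ := Topological.copy cartesian_prod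
  (prod_topology (fun i => discrete_topology (T i))).

Definition cprod_one : cartesian_prod := fun i => 1.
Definition cprod_mul (x y : cartesian_prod) : cartesian_prod :=
  fun i => x i * y i.
Definition cprod_inv (x : cartesian_prod) : cartesian_prod := fun i => (x i)^-1.

Lemma cprod_mulA : associative cprod_mul.
Proof. by move=> x y z; apply: functional_extensionality_dep => i; exact: mulgA. Qed.

Lemma cprod_mul1g : left_id cprod_one cprod_mul.
Proof. by move=> x; apply: functional_extensionality_dep => i; exact: mul1g. Qed.

Lemma cprod_mulg1 : right_id cprod_one cprod_mul.
Proof. by move=> x; apply: functional_extensionality_dep => i; exact: mulg1. Qed.

Lemma cprod_mulVg : left_inverse cprod_one cprod_inv cprod_mul.
Proof. by move=> x; apply: functional_extensionality_dep => i; exact: mulVg. Qed.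

Lemma cprod_mulgV : right_inverse cprod_one cprod_inv cprod_mul.
Proof. by move=> x; apply: functional_extensionality_dep => i; exact: mulgV. Qed.

HB.instance Definition _ := isGroup.Build cartesian_prod
  cprod_mulA cprod_mul1g cprod_mulg1 cprod_mulVg cprod_mulgV.

End Product.

Section Completion.
Variable G : groupType.
Implicit Types N M : fin_normal G.

(* For [N `<=` M] this is the canonical projection from G / N to G / M. *)
Definition quot_proj N M (a : quot N) : quot M := \pi_(quot M) (repr a).

Lemma quot_proj_pi N M x : N `<=` M -> quot_proj M (\pi_(quot N) x) = \pi_(quot M) x.
Proof. by move=> NM; apply/esym/quot_eqP/NM; exact: quot_reprP. Qed.

Lemma quot_projM N M (a b : quot N) : N `<=` M ->
  quot_proj M (a * b) = quot_proj M a * quot_proj M b.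
Proof.
move=> NM; elim/quot_elim: a => x; elim/quot_elim: b => y.
by rewrite [_ * _ in LHS]quot_piM !quot_proj_pi // [RHS]quot_piM.
Qed.

Lemma quot_projV N M (a : quot N) : N `<=` M ->
  quot_proj M a^-1 = (quot_proj M a)^-1.
Proof.
move=> NM; elim/quot_elim: a => x.
by rewrite [_^-1 in LHS]quot_piV !quot_proj_pi // [RHS]quot_piV.
Qed.

Definition compatible : set (cartesian_prod (fun N : fin_normal G => quot N)) :=
  [set x | forall N M, N `<=` M -> quot_proj M (x N) = x M].

Lemma compatible_group_closed : group_closed [in compatible].
Proof.
split=> [|x y]; rewrite !inE; first by move=> N M NM; exact: quot_proj_pi.
move=> cx cy N M NM.
by rewrite [LHS]quot_projM // quot_projV // cx // cy.
Qed.

(* The inverse limit of the finite quotients of G, with the subspace topology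
   (inherited from the generic instance on [set_type]). *)
Definition profinite_completion : Type := compatible.

HB.instance Definition _ := Topological.on profinite_completion.
HB.instance Definition _ := SubChoice.on profinite_completion.
HB.instance Definition _ := SubChoice_isSubGroup.Build _ _ profinite_completion
  compatible_group_closed.

End Completion.

(* Main.v *)
Require Import Defs.
From HB Require Import structures.
From mathcomp Require Import all_boot all_order all_algebra all_fingroup all_solvable.
From mathcomp Require Import all_classical reals topology.
From mathcomp Require Import generic_quotient zify.

Set Implicit Arguments.
Unset Strict Implicit.
Unset Printing Implicit Defensive.

Local Open Scope group_scope.

(** It suffices to find a finitely generated group A of sequences of even permutations that
    contains every finitely supported such sequence and whose quotient by these has no finite
    image: the images of A under the d given families of homomorphisms then generate a group G
    with the same two properties with respect to the product of the T_n, so that the finite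
    index normal subgroups of G are exactly those containing almost all coordinates.

    The seed of A is a pair (e, z) acting on {1, ..., n} through several copies of the regular
    representation of Sym(m), where m tends slowly to infinity with n: e comes from a
    transposition (0 1) and z from an m-cycle.  For j >= 2 the commutator of e and e^(z^j)
    vanishes for almost all n; as z has finite order in any finite image, e and e^z commute
    there, and t = e e^z, which has order 3, becomes trivial.  If x is trivial in every finite
    image and c^3 = (x c)^2 = 1, then c is trivial as well.  Since t moves a fixed proportion
    of the points, finitely many steps of this kind reach all sequences of even involutions,
    hence e, z and generators of the alternating groups. *)

(** * Products of disjoint cycles *)

Section Blocks.
Variable X : finType.

Definition moved (x : {perm X}) : {set X} := [set i | x i != i].

(** A block may be of any type [B], with its points listed by [p]. The condition [uniq (pts p s)]
    says both that each block has distinct points and that different blocks are disjoint. *)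
Definition pts (B : Type) (p : B -> seq X) (s : seq B) : seq X := flatten (map p s).

Definition local (B : Type) (p : B -> seq X) (F : B -> {perm X}) :=
  forall q, perm_on [set i in p q] (F q).

Definition blk (B : Type) (F : B -> {perm X}) (s : seq B) := \prod_(q <- s) F q.

Lemma blk_cons B (F : B -> {perm X}) q s : blk F (q :: s) = F q * blk F s.
Proof. by rewrite /blk big_cons. Qed.

Lemma blk_cat B (F : B -> {perm X}) s1 s2 : blk F (s1 ++ s2) = blk F s1 * blk F s2.
Proof. by rewrite /blk big_cat. Qed.

Lemma blk_map B C (h : C -> B) (F : B -> {perm X}) s : blk F (map h s) = blk (F \o h) s.
Proof. by rewrite /blk big_map. Qed.

Lemma pts_cat B (p : B -> seq X) s1 s2 : pts p (s1 ++ s2) = pts p s1 ++ pts p s2.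
Proof. by rewrite /pts map_cat flatten_cat. Qed.

Lemma pts_cons B (p : B -> seq X) q s : pts p (q :: s) = p q ++ pts p s.
Proof. by []. Qed.

Lemma pts_map_sub B C (h : C -> B) (p : B -> seq X) (p' : C -> seq X) s :
  (forall q, {subset p (h q) <= p' q}) -> {subset pts p (map h s) <= pts p' s}.
Proof.
move=> hs; elim: s => //= q s IH i; rewrite !pts_cons !mem_cat.
by case/orP => [/hs ->|/IH ->] //; rewrite orbT.
Qed.

Lemma pts_map_uniq B C (h : C -> B) (p : B -> seq X) (p' : C -> seq X) s :
  (forall q, uniq (p' q) -> uniq (p (h q))) -> (forall q, {subset p (h q) <= p' q}) ->
  uniq (pts p' s) -> uniq (pts p (map h s)).
Proof.
move=> hu hs; elim: s => //= q s IH; rewrite !pts_cons !cat_uniq => /and3P[uq d us].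
apply/and3P; split; [exact: hu|apply/hasPn => i ir|exact: IH].
apply/negP => /hs iq; move/hasPn: d => /(_ i (pts_map_sub hs ir)) /=.
by rewrite iq.
Qed.

Lemma blk_on B (p : B -> seq X) F s : local p F -> perm_on [set i in pts p s] (blk F s).
Proof.
move=> lF; elim: s => [|q s IH]; first by rewrite /blk big_nil perm_on1.
rewrite blk_cons; apply: perm_onM.
  by apply/fintype.subsetP => i /(fintype.subsetP (lF q)); rewrite !inE mem_cat => ->.
by apply/fintype.subsetP => i /(fintype.subsetP IH); rewrite !inE mem_cat => ->; rewrite orbT.
Qed.

Lemma commute_disjoint (s1 s2 : seq X) (x y : {perm X}) :
  perm_on [set i in s1] x -> perm_on [set i in s2] y -> ~~ has (mem s1) s2 -> commute x y.
Proof.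
move=> px py h; apply: (perm_onC px py).
rewrite disjoint_subset; apply/fintype.subsetP => i; rewrite !inE => i1.
by apply/negP => /(hasPn h); rewrite /= i1.
Qed.

(** Permutations of disjoint blocks commute, so they multiply block by block. With [blk1] and
    [eq_blk] this reduces identities between long products to a computation in one block. *)
Lemma blkM B (p : B -> seq X) F G s : local p F -> local p G -> uniq (pts p s) ->
  blk F s * blk G s = blk (fun q => F q * G q) s.
Proof.
move=> lF lG; elim: s => [|q s IH] us; first by rewrite /blk !big_nil mulg1.
move: us; rewrite /pts /= cat_uniq => /and3P[_ h us].
rewrite !blk_cons -(IH us) -(mulgA (F q)) (mulgA (blk F s)).
have -> : blk F s * G q = G q * blk F s.
  apply: commute_sym; apply: (commute_disjoint (lG q) (blk_on s lF)); exact: h.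
by rewrite !mulgA.
Qed.

Lemma blk1 B (p : B -> seq X) F s : uniq (pts p s) ->
  (forall q, uniq (p q) -> F q = 1) -> blk F s = 1.
Proof.
move=> us F1; elim: s us => [|q s IH]; first by rewrite /blk !big_nil.
rewrite /pts /= cat_uniq => /and3P[uq _ us].
by rewrite blk_cons IH // F1 // mulg1.
Qed.

Lemma eq_blk B (p : B -> seq X) F G s : uniq (pts p s) ->
  (forall q, uniq (p q) -> F q = G q) -> blk F s = blk G s.
Proof.
move=> us F1; elim: s us => [|q s IH]; first by rewrite /blk !big_nil.
rewrite /pts /= cat_uniq => /and3P[uq _ us].
by rewrite !blk_cons IH // F1 //.
Qed.

Lemma localM B (p : B -> seq X) F G : local p F -> local p G ->
  local p (fun q => F q * G q).
Proof. by move=> lF lG q; apply: perm_onM. Qed.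

(* Locked so that [permM] does not see through it. *)
Definition c3 (a b c : X) : {perm X} := locked (tperm a b * tperm a c).

Lemma c3E a b c w : uniq [:: a; b; c] ->
  c3 a b c w = if w == a then b else if w == b then c else if w == c then a else w.
Proof.
rewrite /= !inE negb_or andbT => /andP[/andP[ab ac] bc].
rewrite /c3 -lock permM !permE /=; case: (eqVneq w a) => [_|wa]; first by rewrite (negPf bc) eq_sym (negPf ab).
case: (eqVneq w b) => [_|wb]; first by rewrite eqxx.
by rewrite (negPf wa).
Qed.

Lemma c3_on a b c : perm_on [set i in [:: a; b; c]] (c3 a b c).
Proof.
rewrite /c3 -lock; apply: perm_onM.
  by apply/fintype.subsetP => i /(fintype.subsetP (tperm_on a b)); rewrite !inE; case/orP => ->; rewrite ?orbT.
by apply/fintype.subsetP => i /(fintype.subsetP (tperm_on a c)); rewrite !inE; case/orP => ->; rewrite ?orbT.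
Qed.

Lemma c3_on_sub a b c (s : seq X) : a \in s -> b \in s -> c \in s ->
  perm_on [set i in s] (c3 a b c).
Proof.
move=> sa sb sc; apply/fintype.subsetP => i /(fintype.subsetP (c3_on a b c)); rewrite !inE.
by case/or3P => /eqP ->.
Qed.

Lemma c3_rot a b c : uniq [:: a; b; c] -> c3 a b c = c3 b c a.
Proof.
move=> u; have u' : uniq [:: b; c; a] by move: u; rewrite -(rot_uniq 1).
apply/permP => w; rewrite !c3E //; move: u; rewrite /= !inE negb_or andbT => /andP[/andP[ab ac] bc].
by case: (eqVneq w a) => [->|]; rewrite ?(negPf ab) ?(negPf ac) //; case: eqVneq => // _; case: eqVneq.
Qed.

Lemma c3V a b c : uniq [:: a; b; c] -> (c3 a b c)^-1 = c3 a c b.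
Proof. by move=> _; rewrite /c3 -!lock invgM !tpermV. Qed.

Lemma c3_cube a b c : uniq [:: a; b; c] -> c3 a b c * c3 a b c * c3 a b c = 1.
Proof.
move=> u; apply/permP => w; rewrite perm1 !permM !c3E //.
move: u; rewrite /= !inE negb_or andbT => /andP[/andP[ab ac] bc].
case: (eqVneq w a) => [->|wa]; first by rewrite (eq_sym b) (negPf ab) eqxx eq_sym (negPf ac) (eq_sym c) (negPf bc) eqxx.
case: (eqVneq w b) => [->|wb]; first by rewrite (eq_sym c) (negPf ac) (eq_sym c) (negPf bc) !eqxx.
case: (eqVneq w c) => [->|wc]; first by rewrite eqxx (eq_sym b) (negPf ab) eqxx.
by rewrite (negPf wa) (negPf wb) (negPf wc) (negPf wa) (negPf wb) (negPf wc).
Qed.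

(** Read forwards, this links neighbouring windows in [slide]; read backwards, it writes a pair of
    disjoint transpositions as a product of two 3-cycles. *)
Lemma c3_c3 a b c d : uniq [:: a; b; c; d] ->
  c3 a b c * c3 b c d = tperm a c * tperm b d.
Proof.
move=> u; have u1 : uniq [:: a; b; c].
  by move: u; rewrite -[[:: a; b; c; d]]/([:: a; b; c] ++ [:: d]) cat_uniq => /and3P[].
have u2 : uniq [:: b; c; d] by move: u => /= /andP[].
apply/permP => w; rewrite !permM !c3E // !permE /=.
move: u; rewrite /= !inE !negb_or andbT => /and3P[/and3P[ab ac ad] /andP[bc bd] cd].
case: (eqVneq w a) => [_|wa]; first by rewrite ?eqxx (eq_sym c) (negPf bc) (negPf cd).
case: (eqVneq w b) => [->|wb].
  by rewrite (negPf bc) ?eqxx eq_sym (negPf bc).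
case: (eqVneq w c) => [_|wc].
  by rewrite ?(negPf ab) ?(negPf ac) ?(negPf ad).
by rewrite ?(negPf wb) ?(negPf wc).
Qed.

Lemma dtperm_sq (a b c d : X) : uniq [:: a; b; c; d] ->
  tperm a c * tperm b d * (tperm a c * tperm b d) = 1.
Proof.
move=> u; rewrite mulgA -(mulgA (tperm a c)).
have -> : tperm b d * tperm a c = tperm a c * tperm b d.
  apply: (@commute_disjoint [:: b; d] [:: a; c]).
  - by apply/fintype.subsetP => i /(fintype.subsetP (tperm_on b d)); rewrite !inE.
  - by apply/fintype.subsetP => i /(fintype.subsetP (tperm_on a c)); rewrite !inE.
  move: u; rewrite /= !inE !negb_or andbT => /and3P[/and3P[ab ac ad] /andP[bc bd] cd].
  by rewrite ab ad cd eq_sym bc.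
by rewrite mulgA tperm2 mul1g tperm2.
Qed.

Definition triple : Type := (X * X * X)%type.
Definition tpts (t : triple) : seq X := [:: t.1.1; t.1.2; t.2].
Definition tc3 (t : triple) := c3 t.1.1 t.1.2 t.2.
Definition tinv (t : triple) : triple := (t.1.1, t.2, t.1.2).

Lemma tc3_local : local tpts tc3. Proof. by move=> q; apply: c3_on. Qed.

(** The permutations of cycle type 3^M, with all remaining points fixed. *)
Definition cls (M : nat) (x : {perm X}) :=
  exists s : seq triple, [/\ size s = M, uniq (pts tpts s) & x = blk tc3 s].

Lemma blk_cube s : uniq (pts tpts s) -> blk tc3 s * blk tc3 s * blk tc3 s = 1.
Proof.
move=> us; have l := tc3_local; have l2 := localM l l.
rewrite (blkM l l us) (blkM l2 l us); apply: (blk1 us) => q uq; exact: c3_cube.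
Qed.

Lemma cls_cube M x : cls M x -> x * x * x = 1.
Proof. by case=> s [_ us ->]; apply: blk_cube. Qed.

Lemma size_tpts s : size (pts tpts s) = (3 * size s)%N.
Proof. by elim: s => //= t s IH; rewrite /pts /= in IH *; rewrite IH mulnS. Qed.

Lemma perm_pts_tinv s : perm_eq (pts tpts (map tinv s)) (pts tpts s).
Proof.
elim: s => //= t s IH; rewrite /pts /= perm_cons -/(pts _ _) -/(pts _ s).
move: (pts _ _) IH => r IH; change (perm_eq ([:: t.2] ++ [:: t.1.2] ++ r) (t.1.2 :: t.2 :: pts tpts s)).
by rewrite perm_catCA /= !perm_cons.
Qed.

Lemma blk_tinv s : uniq (pts tpts s) -> blk tc3 (map tinv s) = (blk tc3 s)^-1.
Proof.
move=> us; apply/esym/eqP; rewrite eq_invg_mul blk_map.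
have l' : local tpts (tc3 \o tinv).
  by move=> q; apply: c3_on_sub; rewrite !inE eqxx ?orbT.
rewrite (blkM tc3_local l' us); apply/eqP; apply: (blk1 us) => q uq.
by rewrite /= /tc3 /= -(c3V uq) mulgV.
Qed.

Lemma clsV M x : cls M x -> cls M x^-1.
Proof.
case=> s [sz us ->]; exists (map tinv s).
by rewrite size_map sz (perm_uniq (perm_pts_tinv s)) us blk_tinv.
Qed.

(** A homomorphism that kills [x] turns this into [y^2 = 1], and so kills [y] as well whenever
    [y^3 = 1]. *)
Definition link (x y : {perm X}) := x * y * (x * y) = 1.

Lemma linkC x y : link x y -> link y x.
Proof.
rewrite /link => h.
have -> : y * x * (y * x) = x^-1 * (x * y * (x * y)) * x by rewrite !mulgA mulVg mul1g.
by rewrite h mulg1 mulVg.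
Qed.

(* Sliding a window of three through six disjoint layers a, b, c, d, e, f:
   (a b c) -- (b c d) -- (c d e) -- (d e f), where consecutive elements generate copies of Alt(4). *)
Lemma slide s1 s2 : size s1 = size s2 -> uniq (pts tpts (s1 ++ s2)) ->
  exists y1 y2, [/\ cls (size s1) y1, cls (size s1) y2,
    link (blk tc3 s1) y1, link y1 y2 & link y2 (blk tc3 s2)].
Proof.
(* Pairing the triples of [s1] and [s2] gives blocks of six points, so that the four windows can be
   compared one block at a time. *)
move=> sz us; pose s := zip s1 s2.
pose p (q : triple * triple) := tpts q.1 ++ tpts q.2.
have us' : uniq (pts p s).
  suff e : perm_eq (pts p s) (pts tpts (s1 ++ s2)) by rewrite (perm_uniq e).
  rewrite /s; elim: s1 s2 sz {us s} => [|t1 s1 IH] [|t2 s2] //= [sz].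
  rewrite !pts_cons !pts_cat pts_cons -catA perm_cat2l perm_sym perm_catCA perm_cat2l perm_sym.
  by rewrite -pts_cat IH.
have e1 : blk tc3 s1 = blk (fun q => tc3 q.1) s by rewrite -(blk_map fst) -/(unzip1 _) unzip1_zip ?sz.
have e2 : blk tc3 s2 = blk (fun q => tc3 q.2) s by rewrite -(blk_map snd) -/(unzip2 _) unzip2_zip ?sz.
pose h1 (q : triple * triple) : triple := (q.1.1.2, q.1.2, q.2.1.1).
pose h2 (q : triple * triple) : triple := (q.1.2, q.2.1.1, q.2.1.2).
have l0 : local p (fun q => tc3 q.1) by move=> q; apply: c3_on_sub; rewrite !inE eqxx ?orbT.
have l3 : local p (fun q => tc3 q.2) by move=> q; apply: c3_on_sub; rewrite !inE eqxx ?orbT.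
have l1 : local p (tc3 \o h1) by move=> q; apply: c3_on_sub; rewrite !inE eqxx ?orbT.
have l2 : local p (tc3 \o h2) by move=> q; apply: c3_on_sub; rewrite !inE eqxx ?orbT.
have szs : size s = size s1 by rewrite size_zip sz minnn.
have lk F G : local p F -> local p G ->
    (forall q, uniq (p q) -> F q * G q * (F q * G q) = 1) -> link (blk F s) (blk G s).
  move=> lF lG h; rewrite /link (blkM lF lG us') (blkM (localM lF lG) (localM lF lG) us').
  exact: (blk1 us').
exists (blk tc3 (map h1 s)), (blk tc3 (map h2 s)); split.
- exists (map h1 s); rewrite size_map szs; split=> //; apply: (pts_map_uniq _ _ us') => [q uq|q i].
    exact: (subseq_uniq (take_subseq _ 3) (subseq_uniq (drop_subseq _ 1) uq)).
  by rewrite !inE => /or3P[] /eqP ->; rewrite eqxx ?orbT.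
- exists (map h2 s); rewrite size_map szs; split=> //; apply: (pts_map_uniq _ _ us') => [q uq|q i].
    exact: (subseq_uniq (take_subseq _ 3) (subseq_uniq (drop_subseq _ 2) uq)).
  by rewrite !inE => /or3P[] /eqP ->; rewrite eqxx ?orbT.
- rewrite e1 blk_map; apply: lk => // q uq; rewrite /= /tc3 /=.
  have u : uniq [:: q.1.1.1; q.1.1.2; q.1.2; q.2.1.1] by exact: (subseq_uniq (take_subseq _ 4) uq).
  by rewrite c3_c3 // dtperm_sq.
- rewrite !blk_map; apply: lk => // q uq; rewrite /= /tc3 /=.
  have u : uniq [:: q.1.1.2; q.1.2; q.2.1.1; q.2.1.2].
    by exact: (subseq_uniq (take_subseq _ 4) (subseq_uniq (drop_subseq _ 1) uq)).
  by rewrite c3_c3 // dtperm_sq.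
- rewrite e2 blk_map; apply: lk => // q uq; rewrite /= /tc3 /=.
  have u : uniq [:: q.1.2; q.2.1.1; q.2.1.2; q.2.2].
    by exact: (subseq_uniq (drop_subseq _ 2) uq).
  by rewrite c3_c3 // dtperm_sq.
Qed.

End Blocks.

(** * Permutations with [x^2 = 1] or [x^3 = 1] as products of disjoint cycles *)

Section Decompose.
Variable X : finType.
Implicit Types x y : {perm X}.

(** As [x] agrees on [S] with a permutation of [S], both [S] and its complement are invariant under
    [x]. Dividing by [y] erases the action on [S] and nothing else. *)
Lemma peel x y (S : {set X}) : perm_on S y -> {in S, x =1 y} ->
  {in S, forall w, (y^-1 * x) w = w} /\
  (forall w, w \notin S -> (y^-1 * x) w = x w /\ x w \notin S).
Proof.
move=> yS xy; have yVS := perm_onV yS; split=> w wS.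
  by rewrite permM xy ?permKV // (perm_closed _ yVS).
rewrite permM (out_perm yVS) //; split=> //; apply/negP => xwS.
move: wS; have -> : w = y^-1 (x w); last by rewrite (perm_closed _ yVS) xwS.
have h : y^-1 (x w) \in S by rewrite (perm_closed _ yVS).
by apply: (@perm_inj _ x); rewrite [RHS]xy // permKV.
Qed.

(** Induction on the number of moved points: a block through a moved point is peeled off, and what
    remains still satisfies [x^k = 1], so that the hypothesis applies to it again. *)
Lemma blk_decomposition B (p : B -> seq X) F k x : local p F ->
    (forall x a, x ^+ k = 1 -> x a != a ->
       exists q, [/\ uniq (p q), a \in p q, {in p q, x =1 F q} & {subset p q <= moved x}]) ->
  x ^+ k = 1 ->
  exists s, [/\ uniq (pts p s), x = blk F s & size (pts p s) = #|moved x|].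
Proof.
move=> lF peelF xk.
(* Containment is enough: a point outside all blocks is fixed by the product, so the listed points
   are exactly the moved ones. *)
suff [s [us -> sm]] : exists s, [/\ uniq (pts p s), x = blk F s & {subset pts p s <= moved x}].
  exists s; split=> //; rewrite -(card_uniqP us); apply: eq_card => i.
  apply/idP/idP => [|]; last first.
    rewrite !inE => h; apply: contraR h => i'; apply/eqP; apply: (out_perm (blk_on s lF)).
    by rewrite inE.
  by move=> /sm.
have [n] := ubnP #|moved x|; elim: n x xk => // n IH x xk; rewrite ltnS => le_n.
have [x1|] := eqVneq x 1.
  by exists [::]; rewrite x1 /blk big_nil /pts /=; split.
move=> /eqP/permP x1; have [a xa] : exists a, x a != a.
  apply/existsP; apply: contraPT isT => /existsPn h.
  by case: x1 => a; rewrite perm1; apply/eqP; rewrite -[_ == _]negbK h.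
have [q [uq aq xq qm]] := peelF _ _ xk xa.
have [h1 h2] := @peel x (F q) [set i in p q] (lF q) (fun w => ltac:(rewrite inE => h; exact: xq)).
set x' := _ * x in h1 h2.
have x'k : x' ^+ k = 1.
  apply/permP => w; rewrite perm1 permX; have [wq|wq] := boolP (w \in [set i in p q]).
    by elim: (k) => //= j ->; apply: h1.
  suff [-> _] : iter k x' w = iter k x w /\ iter k x w \notin [set i in p q].
    by rewrite -permX xk perm1.
  by elim: (k) => //= j [-> jq]; have [-> ->] := h2 _ jq.
have mx' : moved x' \subset moved x :\: [set i in p q].
  apply/fintype.subsetP => w; rewrite !inE => mw.
  have wq : w \notin [set i in p q] by apply: contraNN mw => /h1 ->.
  by have [<- _] := h2 _ wq; move: wq; rewrite inE => ->.
have am : a \in moved x by rewrite inE.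
have lt_n : #|moved x'| < n.
  apply: leq_trans le_n; apply: proper_card; apply/properP; split.
    by apply: fintype.subset_trans mx' (subsetDl _ _).
  by exists a => //; apply/negP => /(fintype.subsetP mx'); rewrite !inE aq.
have [s [us x's sm]] := IH _ x'k lt_n.
exists (q :: s); rewrite pts_cons blk_cons cat_uniq -x's uq us /x' mulKVg andbT; split=> //=.
  by apply/hasPn => i /sm /(fintype.subsetP mx'); rewrite !inE => /andP[].
move=> i; rewrite mem_cat => /orP[/qm //|/sm /(fintype.subsetP mx')].
by rewrite !inE => /andP[].
Qed.

Definition ppts (t : X * X) : seq X := [:: t.1; t.2].
Definition tc2 (t : X * X) := tperm t.1 t.2.

Lemma tc2_local : local ppts tc2.
Proof. by move=> q; apply/fintype.subsetP => i /(fintype.subsetP (tperm_on _ _)); rewrite !inE. Qed.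

Lemma involution_decomposition x : x ^+ 2 = 1 ->
  exists s, [/\ uniq (pts ppts s), x = blk tc2 s & (2 * size s)%N = #|moved x|].
Proof.
move=> x2; have [y a y2 ya|s [us xs <-]] := blk_decomposition tc2_local _ x2.
  have yy b : y (y b) = b by rewrite -permM -expg2 y2 perm1.
  exists (a, y a); split; rewrite /ppts /= ?inE ?eqxx ?andbT //; first by rewrite eq_sym.
    by move=> i; rewrite !inE => /orP[]/eqP ->; rewrite /tc2 /= ?yy (tpermL, tpermR).
  by move=> i; rewrite !inE => /orP[]/eqP ->; rewrite ?yy // eq_sym.
exists s; split=> //; elim: s {us xs} => // t s IH.
by rewrite pts_cons size_cat -IH /= mulnS.
Qed.

Lemma cube_decomposition x : x ^+ 3 = 1 -> exists2 M, cls M x & (3 * M)%N = #|moved x|.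
Proof.
move=> x2; have [y a y3 ya|s [us xs <-]] := blk_decomposition (@tc3_local X) _ x2.
  have yy b : y (y (y b)) = b by have := permX y b 3; rewrite y3 perm1.
  have ya2 : y (y a) != y a by rewrite (inj_eq perm_inj).
  have ya3 : y (y a) != a by apply: contra ya => /eqP h; rewrite -{1}h yy.
  have u : uniq [:: a; y a; y (y a)] by rewrite /= !inE negb_or andbT ![a == _]eq_sym ya ya3 eq_sym.
  exists (a, y a, y (y a)); split; rewrite // /tpts /= ?inE ?eqxx //.
    move=> i; rewrite !inE /tc3 /= => h; rewrite c3E //.
    case: (eqVneq i a) h => [-> //|ia]; case: (eqVneq i (y a)) => [-> //|iya] /=.
    by move=> /eqP ->; rewrite eqxx yy.
  by move=> i; rewrite !inE => /or3P[]/eqP ->; rewrite ?yy // eq_sym.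
by exists (size s); [exists s|rewrite size_tpts].
Qed.

End Decompose.

(** * Factorisations and paths through permutations of cycle type 3^M *)

Section Products.
Variable X : finType.
Implicit Types x y : {perm X}.

Lemma triples_of_seq M (l : seq X) : (3 * M <= size l)%N ->
  exists s : seq (triple X), size s = M /\ subseq (pts (@tpts X) s) l.
Proof.
elim: M l => [|M IH] l; first by exists [::]; rewrite sub0seq.
rewrite mulnS; case: l => [|a [|b [|c l]]] // h.
have [|s [sz sub]] := IH l; first by move: h => /=; lia.
exists ((a, b, c) :: s); rewrite /= sz; split=> //.
by rewrite pts_cons /= !eqxx.
Qed.

Lemma fresh_triples (l0 : seq X) M : (size l0 + 3 * M <= #|X|)%N ->
  exists s : seq (triple X), [/\ size s = M, uniq (pts (@tpts X) s) &
    ~~ has (mem l0) (pts (@tpts X) s)].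
Proof.
move=> h; pose l := [seq i <- enum X | i \notin l0].
have szl : (3 * M <= size l)%N.
  have e : (count (mem l0) (enum X) + size l = #|X|)%N.
    by rewrite size_filter [RHS]cardE -(count_predC (mem l0)).
  have c0 : (count (mem l0) (enum X) <= size l0)%N.
    rewrite -size_filter; apply: uniq_leq_size; first by rewrite filter_uniq // enum_uniq.
    by move=> i; rewrite mem_filter => /andP[].
  by rewrite -(leq_add2l (size l0)); apply: leq_trans h _; rewrite -e leq_add2r.
have [s [sz sub]] := triples_of_seq szl.
exists s; split=> //; first by apply: subseq_uniq sub _; rewrite filter_uniq // enum_uniq.
by apply/hasPn => i /(mem_subseq sub); rewrite mem_filter => /andP[].
Qed.

Fixpoint cls_path M n x y : Prop :=
  if n is n'.+1 then exists z, [/\ cls M z, link x z & cls_path M n' z y] else x = y.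

(** Choose [M] triples that avoid those of [x] and of [y]. By [slide], three links lead from [x] to
    their product and three more from there to [y]. Three sets of [M] triples need [9 * M]
    points. *)
Lemma cls_path6 M x y : cls M x -> cls M y -> (9 * M <= #|X|)%N -> cls_path M 6 x y.
Proof.
case=> sx [szx ux ->] [sy [szy uy ->]] h.
have [|s [sz us d]] := @fresh_triples (pts (@tpts X) sx ++ pts (@tpts X) sy) M.
  by rewrite size_cat !size_tpts; lia.
have dx : uniq (pts (@tpts X) (sx ++ s)).
  rewrite pts_cat cat_uniq ux us andbT; apply: contraNN d => /hasP[i i1 i2].
  by apply/hasP; exists i => //=; rewrite mem_cat i2.
have dy : uniq (pts (@tpts X) (sy ++ s)).
  rewrite pts_cat cat_uniq uy us andbT; apply: contraNN d => /hasP[i i1 i2].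
  by apply/hasP; exists i => //=; rewrite mem_cat i2 orbT.
have [|x1 [x2 [c1 c2 l1 l2 l3]]] := slide _ dx; first by rewrite szx.
have [|y1 [y2 [c3 c4 k1 k2 k3]]] := slide _ dy; first by rewrite szy.
rewrite szx in c1 c2; rewrite szy in c3 c4.
exists x1; split=> //; exists x2; split=> //; exists (blk (@tc3 X) s); split=> //; first by exists s.
exists y2; split=> //; first exact: linkC.
exists y1; split=> //; first exact: linkC.
by exists (blk (@tc3 X) sy); split=> //; [exists sy|apply: linkC].
Qed.

Lemma cls_split a b x : cls (a + b) x -> exists y z, [/\ cls a y, cls b z & x = y * z].
Proof.
case=> s [sz us ->]; move: us; rewrite -(cat_take_drop a s) pts_cat cat_uniq => /and3P[u1 _ u2].
exists (blk (@tc3 X) (take a s)), (blk (@tc3 X) (drop a s)); split.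
- by exists (take a s); rewrite size_takel // sz leq_addr.
- by exists (drop a s); rewrite size_drop sz addKn.
by rewrite blk_cat.
Qed.

(* With t supported off y, y^-1 = y^2 = (y t)(y t^-1). *)
Lemma cls_enlarge j M y : cls j y -> (j <= M)%N -> (3 * M <= #|X|)%N ->
  exists u v, [/\ cls M u, cls M v & y = u * v].
Proof.
move=> yj jM h; have y3 := cls_cube yj; case: yj => s [sz us ys].
have [|s2 [sz2 us2 d]] := @fresh_triples (pts (@tpts X) s) (M - j).
  by rewrite !size_tpts; lia.
pose t := blk (@tc3 X) s2.
have szM : (size s + size s2 = M)%N by lia.
have u1 : cls M (y * t).
  exists (s ++ s2); rewrite size_cat pts_cat cat_uniq us us2 /= blk_cat -ys szM; split=> //.
  by rewrite andbT; apply: contraNN d.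
have u2 : cls M (y * t^-1).
  exists (s ++ map (@tinv X) s2); rewrite size_cat size_map pts_cat cat_uniq us blk_cat -ys szM.
  rewrite (perm_uniq (perm_pts_tinv _)) us2 blk_tinv //; split=> //=; rewrite andbT.
  by rewrite (perm_has _ (perm_pts_tinv _)).
exists (y * t^-1)^-1, (y * t)^-1; split; [exact: clsV|exact: clsV|].
have yt : y * t = t * y.
  rewrite ys; exact: (commute_disjoint (blk_on s (@tc3_local X)) (blk_on s2 (@tc3_local X)) d).
rewrite -invgM.
have -> : y * t * (y * t^-1) = y * y by rewrite -mulgA (mulgA t) -yt mulgK.
by apply/eqP; rewrite eq_sym eq_invg_mul y3.
Qed.

Lemma cls_c3 (a b c : X) : uniq [:: a; b; c] -> cls 1 (c3 a b c).
Proof.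
by move=> u; exists [:: (a, b, c)]; split; rewrite //= /blk big_seq1.
Qed.

Definition quad : Type := ((X * X) * (X * X))%type.

(** By divisibility the transpositions can be grouped in pairs, and each pair satisfies
    [(a c)(b d) = (a b c)(b c d)]. The first 3-cycles make up [y], the second ones [z]. *)
Lemma involution_cls x : x ^+ 2 = 1 -> (4 %| #|moved x|)%N ->
  exists j y z, [/\ cls j y, cls j z, x = y * z & (4 * j)%N = #|moved x|].
Proof.
move=> /involution_decomposition[s [us -> <-]]; rewrite -[4]/(2 * 2)%N dvdn_pmul2l // => ev.
have [s' [ss szs]] : exists s' : seq quad, s = flatten [seq [:: q.1; q.2] | q <- s'] /\
    size s = (2 * size s')%N.
  case/dvdnP: ev => m; elim: m s {us} => [|m IH] s sz.
    by exists [::]; rewrite sz; split=> //; apply/nilP; rewrite /nilp sz.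
  case: s sz => [|p1 [|p2 s]] // [sz].
  have [|s' [-> sz']] := IH s; first by lia.
  exists ((p1, p2) :: s'); split=> //=; rewrite sz'; lia.
pose p (q : quad) := ppts q.1 ++ ppts q.2.
have es : pts (@ppts X) s = pts p s'.
  by rewrite ss; elim: (s') => // q r IH; rewrite /= !pts_cons IH catA.
have eb : blk (@tc2 X) s = blk (fun q : quad => tc2 q.1 * tc2 q.2) s'.
  rewrite ss; elim: (s') => [|q r IH]; first by rewrite /blk !big_nil.
  by rewrite /= !blk_cons IH mulgA.
pose h1 (q : quad) : triple X := (q.1.1, q.2.1, q.1.2).
pose h2 (q : quad) : triple X := (q.2.1, q.1.2, q.2.2).
rewrite es in us.
have l1 : local p (@tc3 X \o h1) by move=> q; apply: c3_on_sub; rewrite !inE eqxx ?orbT.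
have l2 : local p (@tc3 X \o h2) by move=> q; apply: c3_on_sub; rewrite !inE eqxx ?orbT.
have uq4 q : uniq (p q) -> uniq [:: q.1.1; q.2.1; q.1.2; q.2.2].
  move=> u; apply: etrans u; apply: perm_uniq; rewrite /p /= perm_cons.
  by apply/seq.permP => P /=; lia.
exists (size s'), (blk (@tc3 X) (map h1 s')), (blk (@tc3 X) (map h2 s')); split.
- exists (map h1 s'); rewrite size_map; split=> //; apply: (pts_map_uniq _ _ us) => [q /uq4 u|q i].
    exact: (subseq_uniq (take_subseq _ 3) u).
  by rewrite !inE => /or3P[] /eqP ->; rewrite eqxx ?orbT.
- exists (map h2 s'); rewrite size_map; split=> //; apply: (pts_map_uniq _ _ us) => [q /uq4 u|q i].
    exact: (subseq_uniq (drop_subseq _ 1) u).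
  by rewrite !inE => /or3P[] /eqP ->; rewrite eqxx ?orbT.
- rewrite eb !blk_map (blkM l1 l2 us); apply: (eq_blk us) => q /uq4 u.
  by rewrite /= /tc3 /= c3_c3.
by rewrite szs mulnA.
Qed.

Lemma even_involution_moved x : x ^+ 2 = 1 -> ~~ odd_perm x -> (4 %| #|moved x|)%N.
Proof.
move=> /involution_decomposition[s [us -> <-]]; rewrite odd_perm_prod; last first.
  elim: s us => // q s IH; rewrite pts_cons cat_uniq => /and3P[uq _ /IH h].
  by rewrite /= h andbT; move: uq; rewrite /= inE andbT.
by move=> h; rewrite -[4]/(2 * 2)%N dvdn_pmul2l // dvdn2.
Qed.

Lemma cube_even x : x ^+ 3 = 1 -> ~~ odd_perm x.
Proof.
by move/(congr1 (@odd_perm X)); rewrite odd_perm1 !expgS expg0 mulg1 !odd_permM; case: (odd_perm x).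
Qed.

End Products.

(** * Generators of alternating groups *)

Section AltGeneration.
Variable X : finType.

Lemma c3J (a b c : X) s : (c3 a b c) ^ s = c3 (s a) (s b) (s c).
Proof. by rewrite /c3 -!lock conjMg !tpermJ. Qed.

Lemma c3_swap (a b c : X) : uniq [:: a; b; c] -> c3 b a c = (c3 a b c)^-1.
Proof.
move=> u; rewrite c3V // c3_rot //; move: u; rewrite /= !inE !negb_or !andbT.
by move=> /andP[/andP[ab ac] bc]; rewrite eq_sym ab bc ac.
Qed.

(** The transposition [t] of [x0] and [x1] normalises the group generated by these 3-cycles, and
    together they yield every transposition [(x0 j)], hence the symmetric group. So the 3-cycles
    generate a subgroup of index at most 2; being even, they generate the alternating group. *)
Lemma Alt_sub_c3 (x0 x1 : X) (W : {group {perm X}}) : x0 != x1 ->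
  (forall j, j != x0 -> j != x1 -> c3 x0 x1 j \in W) -> 'Alt_X \subset W.
Proof.
move=> x01 cW; pose C := [set c3 x0 x1 j | j in [pred j | (j != x0) && (j != x1)]].
have sCW : <<C>> \subset W.
  by rewrite gen_subG; apply/fintype.subsetP => _ /imsetP[j /andP[j0 j1] ->]; apply: cW.
apply: fintype.subset_trans sCW; set t := tperm x0 x1.
have uC j : j != x0 -> j != x1 -> uniq [:: x0; x1; j].
  by move=> j0 j1; rewrite /= !inE negb_or x01 eq_sym j0 eq_sym j1.
have tN : <[t]> \subset 'N(<<C>>).
  rewrite cycle_subG inE -genJ gen_subG.
  apply/fintype.subsetP => _ /imsetP[_ /imsetP[j /andP[j0 j1] ->] ->].
  rewrite c3J /t tpermL tpermR tpermD; [|by rewrite eq_sym..].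
  rewrite c3_swap ?uC // groupV mem_gen //; apply/imsetP; exists j => //.
  by rewrite inE j0.
have full : <<C>> * <[t]> = [set: {perm X}].
  apply/eqP; rewrite finset.eqEsubset finset.subsetT -(gen_tperm x0) -norm_joinEr // gen_subG.
  apply/fintype.subsetP => _ /imsetP[j _ ->].
  have tV : t \in <<C>> <*> <[t]> by rewrite mem_gen // inE cycle_id orbT.
  have [->|j0] := eqVneq j x0; first by rewrite tperm1 group1.
  have [->//|j1] := eqVneq j x1.
  have -> : tperm x0 j = (c3 x0 x1 j)^-1 * t by rewrite c3V ?uC // /c3 -lock -mulgA tperm2 mulg1.
  by rewrite groupM // groupV mem_gen // inE mem_gen //; apply/imsetP; exists j; rewrite ?inE ?j0.
have oC : <<C>> \subset 'Alt_X.
  rewrite gen_subG; apply/fintype.subsetP => _ /imsetP[j /andP[j0 j1] ->].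
  by rewrite Alt_even cube_even // !expgS expg0 mulg1 mulgA c3_cube ?uC.
have n1 : 1 < #|X| by rewrite (cardD1 x0) (cardD1 x1) !inE eq_sym x01.
suff -> : <<C>> = 'Alt_X by [].
have le1 : (#|[set: {perm X}]| <= #|<<C>>| * #|<[t]>|)%N.
  by rewrite -full mul_cardG leq_pmulr ?cardG_gt0.
have le2 : #|<[t]>| <= 2 by rewrite dvdn_leq // order_dvdn expgS expg1 tperm2.
apply/eqP; rewrite eqEcard oC /= -(leq_pmul2l (isT : 0 < 2)) (card_Alt n1) -card_Sym.
by apply: leq_trans le1 _; rewrite mulnC leq_mul2r le2 orbT.
Qed.
End AltGeneration.

(** * Multiples of the regular representation *)

Section Extension.
Variables (D X : finType) (f : D -> X).
Hypothesis f_inj : injective f.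

Definition ext_fun (g : {perm D}) (w : X) : X :=
  if [pick p | f p == w] is Some p then f (g p) else w.

Lemma ext_fun_in g p : ext_fun g (f p) = f (g p).
Proof.
rewrite /ext_fun; case: pickP => [q /eqP/f_inj -> //|/(_ p)]; by rewrite eqxx.
Qed.

Lemma ext_fun_out g w : w \notin codom f -> ext_fun g w = w.
Proof.
rewrite /ext_fun => h; case: pickP => [q /eqP e|//].
by move: h; rewrite -e codom_f.
Qed.

Lemma ext_funK g : cancel (ext_fun g) (ext_fun g^-1).
Proof.
move=> w; have [/codomP[p ->]|h] := boolP (w \in codom f); first by rewrite !ext_fun_in permK.
by rewrite !ext_fun_out.
Qed.

Definition ext (g : {perm D}) : {perm X} := perm (can_inj (ext_funK g)).

Lemma extM g h : ext (g * h) = ext g * ext h.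
Proof.
apply/permP => w; rewrite permM !permE.
have [/codomP[p ->]|k] := boolP (w \in codom f); first by rewrite !ext_fun_in permM.
by rewrite !ext_fun_out.
Qed.

Lemma card_moved_ext g : #|moved (ext g)| = #|moved g|.
Proof.
rewrite -(card_imset (moved g) f_inj); apply: eq_card => w; rewrite inE permE.
have [/codomP[p ->]|k] := boolP (w \in codom f).
  by rewrite ext_fun_in (mem_imset _ _ f_inj) inE (inj_eq f_inj).
rewrite ext_fun_out // eqxx; apply/esym/negP => /imsetP[p _ e].
by move: k; rewrite e codom_f.
Qed.
End Extension.

Section Regular.
Variables (gT : finGroupType) (r n : nat).

Definition rmul (x : gT) : {perm gT * 'I_r} :=
  perm (can_inj (fun p => ltac:(by case: p => a b; rewrite /= mulgK) :
     (fun q : gT * 'I_r => (q.1 * x^-1, q.2)) ((fun q => (q.1 * x, q.2)) p) = p)).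

(** The group acts on [r] copies of itself by right translation, and the remaining points of ['I_n]
    are fixed. The action on the copies is free, so every nontrivial element moves all their
    points. *)
Lemma regular_repr : (#|gT| * r <= n)%N ->
  exists rho : gT -> {perm 'I_n}, [/\ {morph rho : x y / x * y} &
    forall x, x != 1 -> #|moved (rho x)| = (#|gT| * r)%N].
Proof.
rewrite -[r in X in X -> _]card_ord -card_prod => le_n.
pose f (p : gT * 'I_r) := widen_ord le_n (enum_rank p).
have f_inj : injective f.
  by move=> p q /(congr1 val)/= /ord_inj/enum_rank_inj.
exists (fun x => ext f_inj (rmul x)); split=> [x y|x x1].
  rewrite -extM; congr ext; apply/permP => p.
  by rewrite permM !permE /= mulgA.
rewrite card_moved_ext -[r in RHS]card_ord -card_prod; apply: eq_card => -[a b].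
rewrite inE permE /= inE; apply/eqP => -[] /eqP.
by rewrite -{2}[a]mulg1 (inj_eq (mulgI a)) (negPf x1).
Qed.
End Regular.

(** * Involutions made even by an extra transposition *)

Section ParityFix.
Variables (X : finType) (x0 x1 : X).
Hypothesis x01 : x0 != x1.

(** Meant for [u] fixing [x0] and [x1]: the extra transposition then commutes with [u], so
    involutions stay involutions. *)
Definition evened (u : {perm X}) := if odd_perm u then u * tperm x0 x1 else u.

Variable u : {perm X}.
Hypotheses (u0 : u x0 = x0) (u1 : u x1 = x1).

Lemma evened_even : ~~ odd_perm (evened u).
Proof.
by rewrite /evened; case: ifP => [h|-> //]; rewrite odd_permM h odd_tperm x01.
Qed.

Lemma evened_sq : u ^+ 2 = 1 -> (evened u) ^+ 2 = 1.
Proof.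
rewrite /evened; case: ifP => // _ u2.
have c : u * tperm x0 x1 = tperm x0 x1 * u.
  by rewrite (conjgC (tperm _ _)) tpermJ u0 u1.
by rewrite expg2 {1}c -mulgA (mulgA u) -[u * u]expg2 u2 mul1g tperm2.
Qed.

(** Conjugation by [u] sends the 3-cycle on [x0], [x1], [j] to the one on [x0], [x1], [u j]. The
    extra transposition can only invert the result, which does not affect membership in [W]. *)
Lemma c3_evened (W : {group {perm X}}) j : evened u \in W -> j != x0 -> j != x1 ->
  c3 x0 x1 j \in W -> c3 x0 x1 (u j) \in W.
Proof.
move=> eW j0 j1 cW; have uj0 : u j != x0 by rewrite -u0 (inj_eq perm_inj).
have uj1 : u j != x1 by rewrite -u1 (inj_eq perm_inj).
have := groupJ cW eW; rewrite c3J /evened; case: ifP => _; last by rewrite u0 u1.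
rewrite !permM u0 u1 tpermL tpermR tpermD 1?eq_sym // c3_swap ?groupV //.
by rewrite /= !inE negb_or x01 eq_sym uj0 eq_sym uj1.
Qed.

End ParityFix.

Section Reflections.
Variable k : nat.
Let X := 'I_k.+3.

(* The product of the reflections for d and d + 1 is the cycle (d d+1 ... k+2). *)
Definition refl_fun (d : nat) (i : X) : X := if i < d then i else inord (k.+2 + d - i).

Lemma refl_funK d : involutive (refl_fun d).
Proof.
move=> i; have := ltn_ord i; rewrite /refl_fun => li; case: (ltnP i d) => [-> //|di].
have e : (inord (k.+2 + d - i) : X) = (k.+2 + d - i)%N :> nat by rewrite inordK //; lia.
rewrite e ltnNge (_ : d <= _)%N /=; last by lia.
by apply: val_inj; rewrite /= inordK; lia.
Qed.

Definition refl d : {perm X} := perm (inv_inj (refl_funK d)).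

Lemma refl_sq d : refl d ^+ 2 = 1.
Proof. by apply/permP => i; rewrite expg2 permM !permE refl_funK. Qed.

Lemma val_refl d (i : X) : (d <= i)%N -> refl d i = (k.+2 + d - i)%N :> nat.
Proof.
move=> di; have := ltn_ord i => li; rewrite permE /refl_fun ltnNge di /= inordK //; lia.
Qed.

Lemma refl_fix d (i : X) : (i < d)%N -> refl d i = i.
Proof. by move=> di; rewrite permE /refl_fun di. Qed.

(** Take the 3-cycle [(0 1 2)] and the reflections for 2 and 3, corrected in parity. The reflections
    send [i] to [k + 4 - i] and then to [i + 1], so conjugation produces [(0 1 i)] for every [i]
    from 2 on, and [Alt_sub_c3] applies. *)
Lemma Alt_generators : exists a b c : {perm X},
  [/\ a ^+ 2 = 1 /\ b ^+ 2 = 1, ~~ odd_perm a, ~~ odd_perm b, cls 1 c &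
   forall W : {group {perm X}}, a \in W -> b \in W -> c \in W -> 'Alt_X \subset W].
Proof.
pose p (i : nat) : X := inord i.
have vp i : (i < k.+3)%N -> p i = i :> nat by move=> h; rewrite /p inordK.
have neq i j : (i < k.+3)%N -> (j < k.+3)%N -> (p i == p j) = (i == j).
  by move=> hi hj; rewrite -val_eqE /= !vp.
have x01 : p 0 != p 1%N by rewrite neq.
exists (evened (p 0) (p 1%N) (refl 2)), (evened (p 0) (p 1%N) (refl 3)), (c3 (p 0) (p 1%N) (p 2)).
have fixd d i : (i < d)%N -> (i < k.+3)%N -> refl d (p i) = p i.
  by move=> h1 h2; apply: refl_fix; rewrite vp.
split; [split; apply: evened_sq; rewrite ?refl_sq ?fixd //|exact: evened_even..| |].
  by apply: cls_c3; rewrite /= !inE !neq.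
move=> W aW bW cW; apply: (Alt_sub_c3 x01) => j j0 j1.
have cW' i : (2 <= i)%N -> (i < k.+3)%N -> c3 (p 0) (p 1%N) (p i) \in W.
  elim: i => // i IH; rewrite leq_eqVlt => /orP[/eqP[<-]//|i2 ik].
  have /IH : (2 <= i)%N by []; move=> /(_ (ltnW ik)) h.
  have e1 : refl 2 (p i) = p (k.+4 - i)%N.
    by apply: val_inj; rewrite /= val_refl vp ?vp; move: i2 ik; clear; lia.
  have h1 : c3 (p 0) (p 1%N) (p (k.+4 - i)%N) \in W.
    by rewrite -e1; apply: c3_evened; rewrite ?fixd ?neq //; move: i2 ik; clear; lia.
  have e2 : refl 3 (p (k.+4 - i)%N) = p i.+1.
    by apply: val_inj; rewrite /= val_refl vp ?vp; move: i2 ik; clear; lia.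
  by rewrite -e2; apply: c3_evened; rewrite ?fixd ?neq //; move: i2 ik; clear; lia.
have -> : j = p j by apply: val_inj; rewrite /= vp.
apply: cW' => //; move: j0 j1; rewrite -!val_eqE /= !vp //; lia.
Qed.
End Reflections.

(** Here [e = (0 1)] and [z = u * v] is the full cycle on [J + 4] points. Thus [e ^ (z ^ j)] is
    [(j j+1)], disjoint from [e] for [2 <= j <= J], while [e * e ^ z] is a 3-cycle. The cycle is
    given by two involutions so that [killed_involution] can be applied to each of them. *)
Lemma base_perms (J : nat) : exists e u v : {perm 'I_J.+4},
  [/\ e ^+ 2 = 1, u ^+ 2 = 1 /\ v ^+ 2 = 1, (e * e ^ (u * v)) ^+ 3 = 1, e * e ^ (u * v) != 1 &
   forall j, (2 <= j <= J)%N -> commute e (e ^ ((u * v) ^+ j))].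
Proof.
pose p (i : nat) : 'I_J.+4 := inord i.
have vp i : (i < J.+4)%N -> p i = i :> nat by move=> h; rewrite /p inordK.
have neq i j : (i < J.+4)%N -> (j < J.+4)%N -> (p i == p j) = (i == j).
  by move=> hi hj; rewrite -val_eqE /= !vp.
pose u := refl J.+1 0; pose v := refl J.+1 1%N; pose z := u * v.
have zS i : (i.+1 < J.+4)%N -> z (p i) = p i.+1.
  move=> h; apply: val_inj; rewrite permM /=.
  have e1 : u (p i) = (J.+3 - i)%N :> nat by rewrite val_refl // vp; lia.
  by rewrite val_refl e1 ?vp; lia.
have zX j i : (i + j < J.+4)%N -> (z ^+ j) (p i) = p (i + j)%N.
  elim: j => [|j IH] h; first by rewrite expg0 perm1 addn0.
  by rewrite expgSr permM IH ?zS ?addnS //; lia.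
pose e := tperm (p 0) (p 1%N); exists e, u, v; rewrite -/z.
have eJ j : (j <= J)%N -> e ^ (z ^+ j) = tperm (p j) (p j.+1).
  by move=> h; rewrite /e tpermJ !zX ?add0n ?add1n //; lia.
have ez : e * e ^ z = c3 (p 1%N) (p 0) (p 2).
  have -> : e ^ z = tperm (p 1%N) (p 2) by rewrite /e tpermJ !zS.
  by rewrite /e tpermC /c3 -lock.
have uq : uniq [:: p 1%N; p 0; p 2] by rewrite /= !inE !neq.
split.
- by rewrite expg2 tperm2.
- by split; apply: refl_sq.
- by rewrite ez !expgSr expg0 mul1g c3_cube.
- rewrite ez; apply/eqP => /permP/(_ (p 0)); rewrite perm1 c3E // eqxx neq //= => /eqP.
  by rewrite neq.
move=> j /andP[j2 jJ]; rewrite eJ //.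
apply: (@commute_disjoint _ [:: p 0; p 1%N] [:: p j; p j.+1]).
- by apply/fintype.subsetP => i /(fintype.subsetP (tperm_on _ _)); rewrite !inE.
- by apply/fintype.subsetP => i /(fintype.subsetP (tperm_on _ _)); rewrite !inE.
by rewrite /= !inE !neq; lia.
Qed.

(** The permutations of [base_perms] act through [r] copies of the regular representation of Sym(J +
    4), whose order is [N]. Each nontrivial element moves [N * r] points, a multiple of 4, so
    [3 * M = N * r]. With [r = n %/ (3 * N)] and [r >= 1] this gives [9 * M = 3 * N * r <= n < 3 * N
    * (r + 1) <= 18 * M]. *)
Lemma base_alt (J : nat) : exists N0, forall n, (N0 <= n)%N ->
  exists (e u v : {perm 'I_n}) (M : nat),
  [/\ e ^+ 2 = 1, u ^+ 2 = 1 /\ v ^+ 2 = 1,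
    [/\ 4 %| #|moved e|, 4 %| #|moved u| & 4 %| #|moved v|]%N,
    cls M (e * e ^ (u * v)) /\ (9 * M <= n <= 18 * M)%N &
    forall j, (2 <= j <= J)%N -> commute e (e ^ ((u * v) ^+ j))].
Proof.
have [e [u [v [e2 [u2 v2] t3 t1 ce]]]] := base_perms J.
pose N := #|{perm 'I_J.+4}|.
have N4 : (4 %| N)%N.
  by rewrite /N -cardsT card_Sym card_ord; apply: dvdn_fact.
have N_gt0 : (0 < N)%N by apply/card_gt0P; exists 1.
exists (3 * N)%N => n le_n; pose r := (n %/ (3 * N))%N.
have hr : (3 * N * r <= n)%N by rewrite mulnC leq_trunc_div.
have hn : (n < 3 * N * r.+1)%N by rewrite mulnC ltn_ceil // muln_gt0.
have r_gt0 : (0 < r)%N by rewrite divn_gt0 // muln_gt0.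
have [|rho [rhoM rho_moved]] := @regular_repr {perm 'I_J.+4} r n.
  by apply: leq_trans hr; rewrite -mulnA leq_pmull.
have rho1 : rho 1 = 1 by apply: (mulgI (rho 1)); rewrite -rhoM !mulg1.
have rhoV x : rho x^-1 = (rho x)^-1 by apply/esym/eqP; rewrite eq_invg_mul -rhoM mulgV rho1.
have rhoX x j : rho (x ^+ j) = rho x ^+ j.
  by elim: j => [|j IH]; rewrite ?expg0 // !expgS rhoM IH.
have rhoJ x y : rho (x ^ y) = rho x ^ rho y by rewrite /conjg !rhoM rhoV.
have d4 x : (4 %| #|moved (rho x)|)%N.
  have [->|x1] := eqVneq x 1; last by rewrite rho_moved // dvdn_mulr.
  rewrite rho1 (_ : moved 1 = finset.set0) ?cards0 //.
  by apply/setP => i; rewrite !inE perm1 eqxx.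
have t3' : rho (e * e ^ (u * v)) ^+ 3 = 1 by rewrite -rhoX t3.
have [M clsM hM] := cube_decomposition t3'.
rewrite rho_moved // -/N in hM.
exists (rho e), (rho u), (rho v), M.
rewrite -rhoM -rhoJ -[X in cls M X]rhoM -!rhoX e2 u2 v2 rho1; split=> //.
  by split=> //; apply/andP; nia.
by move=> j hj; rewrite -rhoX -rhoJ /commute -!rhoM ce.
Qed.

(** * Sequences of permutations that vanish in all finite images *)

Section CartesianProd.
Variables (I : Type) (T : I -> groupType).
Implicit Types x y : cartesian_prod T.

Lemma cprodM x y i : (x * y) i = x i * y i. Proof. by []. Qed.
Lemma cprod1 i : (1 : cartesian_prod T) i = 1. Proof. by []. Qed.
Lemma cprodV x i : (x^-1) i = (x i)^-1. Proof. by []. Qed.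
Lemma cprodX x n i : (x ^+ n) i = x i ^+ n.
Proof. by elim: n => [|n IH]; rewrite ?expg0 // !expgS -IH. Qed.
Lemma cprodJ x y i : (x ^ y) i = x i ^ y i. Proof. by []. Qed.
Lemma cprodP x y : (forall i, x i = y i) -> x = y.
Proof. by move=> h; apply: functional_extensionality_dep. Qed.

End CartesianProd.

Definition fin_supp (T : nat -> groupType) (x : cartesian_prod T) :=
  exists N : nat, forall k, (N <= k)%N -> x k = 1.

(** A finite image of [A] modulo its finitely supported elements. The map [theta] is total, but only
    its values on [A] are constrained. *)
Definition tail_hom (T : nat -> groupType) (A : set (cartesian_prod T)) (Q : groupType)
    (theta : cartesian_prod T -> Q) : Prop :=
  [/\ is_subgroup A, finite_set [set: Q]%classic,
    forall x y, A x -> A y -> theta (x * y) = theta x * theta y &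
    forall x, A x -> fin_supp x -> theta x = 1].

Lemma pigeonhole (Q : Type) (g : nat -> Q) : finite_set [set: Q]%classic ->
  exists m n, (m < n)%N /\ g m = g n.
Proof.
move=> fQ; apply: contrapT => h; apply: infinite_nat.
have := @finite_preimage _ _ setT%classic g; rewrite preimage_setT; apply=> // m n _ _ e.
case: (ltngtP m n) => // lt; case: h; first by exists m, n.
by exists n, m.
Qed.

Section HomOn.
Variables (G Q : groupType) (A : set G).

Definition hom_on (theta : G -> Q) : Prop :=
  is_subgroup A /\ forall x y, A x -> A y -> theta (x * y) = theta x * theta y.

Lemma subgroupX x n : is_subgroup A -> A x -> A (x ^+ n).
Proof.
move=> [A1 AM AV] Ax; elim: n => [|n IH]; rewrite ?expg0 // expgS; exact: AM.
Qed.

Variable theta : G -> Q.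
Hypothesis th : hom_on theta.

Lemma hom_on1 : theta 1 = 1.
Proof.
have [[A1 AM AV] tM] := th; apply: (mulgI (theta 1)).
by rewrite -tM // !mulg1.
Qed.

Lemma hom_onV x : A x -> theta x^-1 = (theta x)^-1.
Proof.
have [[A1 AM AV] tM] := th => Ax.
by apply: (mulgI (theta x)); rewrite -tM ?mulgV ?hom_on1 //; apply: AV.
Qed.

Lemma hom_onJ x y : A x -> A y -> A (x ^ y) /\ theta (x ^ y) = theta x ^ theta y.
Proof.
have [[A1 AM AV] tM] := th => Ax Ay; have Axy := AM _ _ Ax Ay; have AVy := AV _ Ay.
by split; [exact: AM|rewrite /conjg tM // tM // hom_onV].
Qed.

Lemma hom_onX x n : A x -> theta (x ^+ n) = theta x ^+ n.
Proof.
have [sA tM] := th => Ax; elim: n => [|n IH]; first by rewrite !expg0 hom_on1.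
by rewrite !expgS tM ?IH //; apply: subgroupX.
Qed.

Lemma hom_on_ker : is_subgroup [set x | A x /\ theta x = 1]%classic.
Proof.
have [[A1 AM AV] tM] := th; split.
- by split=> //; exact: hom_on1.
- by move=> x y [Ax x1] [Ay y1]; split; [exact: AM|rewrite tM // x1 y1 mulg1].
- by move=> x [Ax x1]; split; [exact: AV|rewrite hom_onV // x1 invg1].
Qed.

End HomOn.

Section TailHom.
Variables (T : nat -> groupType) (A : set (cartesian_prod T)) (Q : groupType).
Variable theta : cartesian_prod T -> Q.
Hypothesis th : tail_hom A theta.

Let hom : hom_on A theta. Proof. by case: th. Qed.

Lemma tail_hom1 : theta 1 = 1. Proof. exact: hom_on1 hom. Qed.

Lemma tail_homV x : A x -> theta x^-1 = (theta x)^-1. Proof. exact: hom_onV hom _. Qed.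

Lemma tail_homX x n : A x -> theta (x ^+ n) = theta x ^+ n. Proof. exact: hom_onX hom _ _. Qed.

Lemma tail_hom_torsion x : A x -> exists2 d : nat, (0 < d)%N & theta x ^+ d = 1.
Proof.
move=> Ax; have [_ fQ _ _] := th.
have [m [n [mn e]]] := @pigeonhole _ (fun n => theta x ^+ n) fQ.
exists (n - m)%N; first by rewrite subn_gt0.
by apply: (mulgI (theta x ^+ m)); rewrite -expgnDr subnKC ?mulg1 // ltnW.
Qed.
End TailHom.

(** Index [k] has degree [k + 1], matching the factors [T n.+1] of the theorem. *)
Notation perm_seq := (cartesian_prod (fun k : nat => {perm 'I_k.+1})).

(** * Spreading triviality in finite images *)

Section Killed.
Variable k0 : nat.

(** The coordinates below [k0] stay trivial; the corresponding finitely many factors are restored in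
    [frame_gens]. *)
Definition alt_seq (x : perm_seq) :=
  forall k, x k \in 'Alt_('I_k.+1) /\ ((k < k0)%N -> x k = 1).

Variables (e u v : perm_seq) (M J : nat -> nat).
Hypothesis e_sq : forall k, e k ^+ 2 = 1.
Hypothesis uv_sq : forall k, u k ^+ 2 = 1 /\ v k ^+ 2 = 1.
Hypothesis euv4 : forall k, [/\ 4 %| #|moved (e k)|, 4 %| #|moved (u k)| & 4 %| #|moved (v k)|]%N.
Hypothesis euv1 : forall k, (k < k0)%N -> [/\ e k = 1, u k = 1 & v k = 1].
Hypothesis M_small : forall k, (9 * M k <= k.+1)%N.
Hypothesis M_large : forall k, (k0 <= k)%N -> (k.+1 <= 18 * M k)%N.
Hypothesis M0 : forall k, (k < k0)%N -> M k = 0%N.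
Hypothesis cls_t : forall k, cls (M k) (e k * e k ^ (u k * v k)).
Hypothesis e_comm : forall k j, (2 <= j <= J k)%N -> commute (e k) (e k ^ ((u k * v k) ^+ j)).
Hypothesis J_unbounded : forall j, exists K, forall k, (K <= k)%N -> (j <= J k)%N.

Let z := u * v.
Let t := e * e ^ z.

(** The set [s] holds the auxiliary sequences through which the triviality of [x] is deduced, and
    [A] must contain them for the deduction to take place in [A]. As all of [s] dies, such sets can
    be united. *)
Definition killed (x : perm_seq) : Prop := exists s : set perm_seq,
  [/\ finite_set s, s x, forall y, s y -> alt_seq y &
    forall A (Q : groupType) (theta : perm_seq -> Q), tail_hom A theta ->
      (s `<=` A)%classic -> A e -> A z -> forall y, s y -> theta y = 1].

Lemma alt_seq_cls (x : perm_seq) : (forall k, cls (M k) (x k)) -> alt_seq x.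
Proof.
move=> cx k; split=> [|kk]; last by have := cx k; rewrite M0 // => -[[|? ?] [// _ _ ->]]; rewrite /blk big_nil.
by rewrite Alt_even cube_even // !expgS expg0 mulg1 mulgA (cls_cube (cx k)).
Qed.

Lemma killed_t : killed t.
Proof.
exists [set t]%classic; split=> //.
  by move=> _ ->; apply: alt_seq_cls.
move=> A Q th tth _ Ae Az _ ->; have [[A1 AM AV] fQ tM tS] := tth.
have AX x n : A x -> A (x ^+ n) by apply: subgroupX; case: tth.
have AJ x y : A x -> A y -> A (x ^ y) by move=> Ax Ay; apply: (AM); [apply: (AV)|apply: (AM)].
have tV x : A x -> th x^-1 = (th x)^-1 by apply: (tail_homV tth).
have [d d0 zd] := tail_hom_torsion tth Az.
have et : e * e = 1 by apply: cprodP => k; rewrite -expg2 cprodX e_sq.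
have c1 : th (e * e ^ z) = th (e ^ z * e).
  have zz : th (e ^ (z ^+ d.+1)) = th (e ^ z).
    have h y : A y -> th (e ^ y) = (th y)^-1 * (th e * th y).
      by move=> Ay; rewrite /conjg tM ?tV ?tM //; [apply: (AV)|apply: (AM)].
    by rewrite (h _ Az) (h _ (AX _ d.+1 Az)) (tail_homX tth _ Az) expgS zd mulg1.
  have Aez : A (e ^ z) by apply: (AJ).
  have Aezd : A (e ^ (z ^+ d.+1)) by apply: (AJ) => //; apply: (AX).
  rewrite tM // [RHS]tM // -zz -!tM //.
  suff h : th ((e ^ (z ^+ d.+1) * e)^-1 * (e * e ^ (z ^+ d.+1))) = 1.
    have AA : A (e ^ (z ^+ d.+1) * e) by apply: (AM).
    apply: (mulgI (th (e ^ (z ^+ d.+1) * e))^-1).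
    by rewrite mulVg -h [RHS]tM ?tV //; [apply: (AV)|apply: (AM)].
  apply: (tS); first by apply: (AM); [apply: (AV)|]; apply: (AM).
  have [K hK] := J_unbounded d.+1; exists K => k kK.
  have := @e_comm k d.+1; rewrite ltnS d0 hK // => /(_ isT) h.
  by rewrite cprodM cprodV !cprodM cprodJ cprodX h mulVg.
have At : A t by apply: (AM) => //; apply: (AJ).
(* By [c1] the elements [t] and [e ^ z * e] have the same image. They are inverse to each other, so
   the image of [t] squares to 1. *)
have t2 : th t ^+ 2 = 1.
  have A' : A (e ^ z * e) by apply: (AM) => //; apply: (AJ).
  have e1 : t * (e ^ z * e) = 1 by rewrite /t mulgA -(mulgA e) -conjMg et conj1g mulg1 et.
  have c1' : th t = th (e ^ z * e) := c1.
  by rewrite expg2 {2}c1' -tM // e1 (tail_hom1 tth).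
have t3 : th t ^+ 3 = 1.
  rewrite -(tail_homX tth) // (_ : t ^+ 3 = 1) ?(tail_hom1 tth) //.
  by apply: cprodP => k; rewrite cprodX !expgS expg0 mulg1 mulgA (cls_cube (cls_t k)).
by rewrite -t3 expgS t2 mulg1.
Qed.

Lemma killed_mul x y : killed x -> killed y -> killed (x * y).
Proof.
case=> sx [fx xx ax kx] [sy [fy yy ay ky]].
exists (sx `|` sy `|` [set x * y])%classic; split.
- by rewrite !finite_setU; split=> //; split.
- by right.
- move=> w [[|]|->]; [exact: ax|exact: ay|move=> k].
  have [x1 x2] := ax _ xx k; have [y1 y2] := ay _ yy k.
  by rewrite cprodM groupM //; split=> // kk; rewrite x2 // y2 // mulg1.
move=> A Q th tth sA Ae Az.
have hx w : sx w -> th w = 1 by apply: (kx A) => // w' w1; apply: sA; left; left.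
have hy w : sy w -> th w = 1 by apply: (ky A) => // w' w1; apply: sA; left; right.
move=> w [[|]|->]; [exact: hx|exact: hy|].
have [[A1 AM AV] fQ tM tS] := tth.
have Ax : A x by apply: sA; left; left.
have Ay : A y by apply: sA; left; right.
by rewrite tM // hx // hy // mulg1.
Qed.

(* c^3 = 1 and (x c)^2 = 1 force c = 1 once x = 1. *)
Lemma killed_link (x c : perm_seq) : killed x -> (forall k, cls (M k) (c k)) ->
  (forall k, link (x k) (c k)) -> killed c.
Proof.
case=> sx [fx xx ax kx] cc lxc.
exists (sx `|` [set c])%classic; split.
- by rewrite finite_setU.
- by right.
- by move=> w [|->]; [exact: ax|exact: alt_seq_cls].
move=> A Q th tth sA Ae Az.
have hx w : sx w -> th w = 1 by apply: (kx A) => // w' w1; apply: sA; left.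
move=> w [|->]; [exact: hx|].
have [[A1 AM AV] fQ tM tS] := tth.
have Ac : A c by apply: sA; right.
have Ax : A x by apply: sA; left.
have c3 : th c ^+ 3 = 1.
  rewrite -(tail_homX tth) // (_ : c ^+ 3 = 1) ?(tail_hom1 tth) //.
  by apply: cprodP => k; rewrite cprodX !expgS expg0 mulg1 mulgA (cls_cube (cc k)).
have c2 : th c ^+ 2 = 1.
  have xc : A (x * c) by apply: AM.
  have := tail_homX tth 2 xc; rewrite (_ : (x * c) ^+ 2 = 1).
    by rewrite (tail_hom1 tth) tM // hx // mul1g => <-.
  by apply: cprodP => k; rewrite cprodX expg2; exact: lxc.
by rewrite -c3 expgS c2 mulg1.
Qed.

(** The intermediate sequences are chosen coordinate by coordinate. As the paths have the same
    length [n] in all coordinates, finitely many sequences suffice. *)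
Lemma killed_path n (x y : perm_seq) : killed x -> (forall k, cls_path (M k) n (x k) (y k)) -> killed y.
Proof.
elim: n x => [|n IH] x kx pxy; first by have <- : x = y by apply: cprodP.
pose w : perm_seq := fun k => projT1 (cid (pxy k)).
have hw k : [/\ cls (M k) (w k), link (x k) (w k) & cls_path (M k) n (w k) (y k)].
  exact: (projT2 (cid (pxy k))).
apply: (IH w); last by move=> k; case: (hw k).
by apply: (killed_link kx) => k; case: (hw k).
Qed.

Lemma killed_cls (x : perm_seq) : (forall k, cls (M k) (x k)) -> killed x.
Proof.
move=> cx; apply: (killed_path killed_t) => k; apply: (cls_path6 (cls_t k) (cx k)).
by rewrite card_ord.
Qed.

Lemma killed_prod2 (R : forall k, {perm 'I_k.+1} -> Prop) (x : perm_seq) :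
  (forall y, (forall k, R k (y k)) -> killed y) ->
  (forall k, exists a b, [/\ R k a, R k b & x k = a * b]) -> killed x.
Proof.
move=> Rk xab.
pose a : perm_seq := fun k => projT1 (cid (xab k)).
have ha k : exists b, [/\ R k (a k), R k b & x k = a k * b] by apply: (projT2 (cid (xab k))).
pose b : perm_seq := fun k => projT1 (cid (ha k)).
have hb k : [/\ R k (a k), R k (b k) & x k = a k * b k] by apply: (projT2 (cid (ha k))).
have -> : x = a * b by apply: cprodP => k; case: (hb k).
by apply: killed_mul; apply: Rk => k; case: (hb k).
Qed.

(** By [cls_enlarge] such a sequence is a product of two sequences to which [killed_cls] applies. *)
Lemma killed_small (x : perm_seq) : (forall k, exists2 j, (j <= M k)%N & cls j (x k)) -> killed x.
Proof.
move=> xj; apply: (@killed_prod2 (fun k => cls (M k))); first exact: killed_cls.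
move=> k; have [j jM cj] := xj k; apply: (cls_enlarge cj jM); rewrite card_ord.
by apply: leq_trans (M_small k); rewrite leq_mul2r orbT.
Qed.

(** Each of [K] rounds splits off at most [M k] cycles in coordinate [k]. The number of rounds is
    the same for all [k], so the result is a finite product of sequences. *)
Lemma killed_bounded K (x : perm_seq) : (forall k, exists2 j, (j <= K * M k)%N & cls j (x k)) -> killed x.
Proof.
elim: K x => [|K IH] x xj; first by apply: killed_small => k; have [j] := xj k; rewrite mul0n leqn0 => /eqP -> c; exists 0%N.
have xab k : exists a, exists b, [/\ exists2 j, (j <= K * M k)%N & cls j a,
    exists2 j, (j <= M k)%N & cls j b & x k = a * b].
  have [j jM cj] := xj k; pose j1 := minn j (M k).
  have [|a [b [ca cb ->]]] := @cls_split _ (j - j1) j1 (x k); first by rewrite subnK // geq_minl.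
  exists a, b; split=> //; last by exists j1; rewrite ?geq_minr.
  by exists (j - j1)%N => //; move: jM; rewrite mulSn /j1; case: leqP; lia.
pose a : perm_seq := fun k => projT1 (cid (xab k)).
have ha k := projT2 (cid (xab k)).
pose b : perm_seq := fun k => projT1 (cid (ha k)).
have hb k := projT2 (cid (ha k)).
have -> : x = a * b by apply: cprodP => k; case: (hb k).
by apply: killed_mul; [apply: IH|apply: killed_small] => k; case: (hb k).
Qed.

(** By [involution_cls] every coordinate is a product of two elements with [j] 3-cycles each, where
    [4 * j] is the number of moved points. So [j <= k + 1 <= 18 * M k] from [k0] on, while below
    [k0] nothing moves and [j = 0]. *)
Lemma killed_involution (x : perm_seq) : (forall k, x k ^+ 2 = 1 /\ (4 %| #|moved (x k)|)%N) ->
  (forall k, (k < k0)%N -> x k = 1) -> killed x.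
Proof.
move=> x2 x1; pose R k y := exists2 j, (j <= 18 * M k)%N & cls j (y : {perm 'I_k.+1}).
apply: (@killed_prod2 R); first exact: killed_bounded.
move=> k; have [xk2 xk4] := x2 k; have [j [y [w [cy cw xyw jm]]]] := involution_cls xk2 xk4.
have jM : (j <= 18 * M k)%N.
  have [kk|kk] := ltnP k k0.
    move: jm; rewrite x1 // (_ : moved 1 = finset.set0) ?cards0; first by case: (j).
    by apply/setP => i; rewrite !inE perm1 eqxx.
  apply: leq_trans (M_large kk); apply: leq_trans (leq_pmull j (isT : 0 < 4)) _.
  by rewrite jm -[X in (_ <= X)%N]card_ord max_card.
by exists y, w; split=> //; exists j.
Qed.

Lemma killed_e : killed e.
Proof. by apply: killed_involution => [k|k /euv1[]//]; have [] := euv4 k. Qed.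

Lemma killed_z : killed z.
Proof.
apply: killed_mul; apply: killed_involution => k; try by case/euv1.
  by have [] := euv4 k; have [] := uv_sq k.
by have [] := euv4 k; have [] := uv_sq k.
Qed.

End Killed.

(** The data of [base_alt] in degree [k + 1], packaged so that they can be chosen for all [k] at
    once. The lower bound on [bM] is kept apart because it fails for the trivial data used below
    [k0]. *)
Record base (k J : nat) := Base {
  be : {perm 'I_k.+1}; bu : {perm 'I_k.+1}; bv : {perm 'I_k.+1}; bM : nat;
  be_sq : be ^+ 2 = 1; buv_sq : bu ^+ 2 = 1 /\ bv ^+ 2 = 1;
  b4 : [/\ 4 %| #|moved be|, 4 %| #|moved bu| & 4 %| #|moved bv|]%N;
  bcls : cls bM (be * be ^ (bu * bv));
  b_small : (9 * bM <= k.+1)%N;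
  bcomm : forall j, (2 <= j <= J)%N -> commute be (be ^ ((bu * bv) ^+ j)) }.

Lemma moved1 (X : finType) : #|moved (1 : {perm X})| = 0%N.
Proof. by apply/eqP; rewrite cards_eq0; apply/eqP/setP => i; rewrite !inE perm1 eqxx. Qed.

Lemma base_trivial k J : {b : base k J | [/\ be b = 1, bu b = 1, bv b = 1 & bM b = 0%N]}.
Proof.
have c : cls 0 (1 * 1 ^ (1 * 1) : {perm 'I_k.+1}).
  by exists [::]; rewrite /blk big_nil conj1g mulg1.
have s : (1 : {perm 'I_k.+1}) ^+ 2 = 1 by rewrite expg1n.
have m : (4 %| #|moved (1 : {perm 'I_k.+1})|)%N by rewrite moved1.
have cm j : (2 <= j <= J)%N -> commute (1 : {perm 'I_k.+1}) (1 ^ ((1 * 1) ^+ j)).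
  by move=> _; rewrite conj1g; apply: commute_refl.
by exists (Base s (conj s s) (And3 m m m) c (isT : (9 * 0 <= k.+1)%N) cm).
Qed.

(** From [k0] on, [J k] is the largest [J <= k] for which data with the lower bound on [bM] exist.
    For each fixed [j] they exist once [k] is large, so [J k] tends to infinity. *)
Lemma base_choice : exists (k0 : nat) (J : nat -> nat) (b : forall k, base k (J k)),
  [/\ forall k, (k0 <= k)%N -> (k.+1 <= 18 * bM (b k))%N,
   forall k, (k < k0)%N -> [/\ be (b k) = 1, bu (b k) = 1, bv (b k) = 1 & bM (b k) = 0%N],
   forall j, exists K, forall k, (K <= k)%N -> (j <= J k)%N &
   (4 <= k0)%N].
Proof.
pose good k J := exists b : base k J, (k.+1 <= 18 * bM b)%N.
have [N hN] : exists N : nat -> nat, forall J k, (N J <= k)%N -> good k J.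
  have [N hN] := choice base_alt; exists N => J k kN.
  have [|e [u [v [M [e2 uv2 m4 [c /andP[s l]] cm]]]]] := hN J k.+1; first exact: ltnW.
  by exists (Base e2 uv2 m4 c s cm).
(* [N 0] makes [J = 0] admissible for every [k >= k0]; the 4 makes the groups Alt(k + 1) simple
   there. *)
pose k0 := maxn (N 0%N) 4.
have ex k : (k0 <= k)%N -> exists J, good k J /\ forall J', (J' <= k)%N -> good k J' -> (J' <= J)%N.
  move=> kk; have g0 : good k 0 by apply: hN; apply: leq_trans kk; rewrite leq_maxl.
  have ex0 : exists J, `[< good k J >] && (J <= k)%N by exists 0%N; rewrite andbT; apply/asboolP.
  have ub J : `[< good k J >] && (J <= k)%N -> (J <= k)%N by case/andP.
  case: (ex_maxnP ex0 ub) => J /andP[/asboolP gJ _] mJ.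
  by exists J; split=> // J' J'k gJ'; apply: mJ; rewrite J'k andbT; apply/asboolP.
have ex' k : exists J, exists b : base k J,
   ((k0 <= k)%N -> (k.+1 <= 18 * bM b)%N /\ forall J', (J' <= k)%N -> good k J' -> (J' <= J)%N) /\
   ((k < k0)%N -> [/\ be b = 1, bu b = 1, bv b = 1 & bM b = 0%N]).
  have [kk|kk] := leqP k0 k; last by have [b hb] := base_trivial k 0; exists 0%N, b; split=> // h; lia.
  by have [J [[b lb] mJ]] := ex k kk; exists J, b; split=> // h; lia.
pose J k := projT1 (cid (ex' k)); pose b k := projT1 (cid (projT2 (cid (ex' k)))).
have hb k := projT2 (cid (projT2 (cid (ex' k)))).
exists k0, J, b; split.
- by move=> k kk; have [/(_ kk)[]] := hb k.
- by move=> k kk; have [_ /(_ kk)] := hb k.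
- move=> j; exists (maxn k0 (maxn (N j) j)) => k; rewrite !geq_max => /and3P[k1 k2 k3].
  have kk : (k0 <= k)%N by rewrite /k0 geq_max.
  by have [/(_ kk)[_ h] _] := hb k; apply: h => //; apply: hN.
- exact: leq_maxr.
Qed.

Lemma Alt_generators' k : (2 <= k)%N -> exists a b c : {perm 'I_k.+1},
  [/\ a ^+ 2 = 1 /\ b ^+ 2 = 1, ~~ odd_perm a, ~~ odd_perm b, cls 1 c &
   forall W : {group {perm 'I_k.+1}}, a \in W -> b \in W -> c \in W -> 'Alt_('I_k.+1) \subset W].
Proof. by case: k => [|[|k]] // _; apply: Alt_generators. Qed.

(** The set is the union of the witnesses for [e], [z] and generators [a], [b], [c] of the
    alternating groups. It contains [e] and [z], so the conditions [A e] and [A z] in [killed]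
    become automatic. *)
Lemma perfect_family : exists (k0 : nat) (s : set perm_seq),
  [/\ (4 <= k0)%N, finite_set s, forall x, s x -> alt_seq k0 x,
   forall k (W : {group {perm 'I_k.+1}}), (k0 <= k)%N ->
     (forall x, s x -> x k \in W) -> 'Alt_('I_k.+1) \subset W &
   forall A (Q : groupType) (theta : perm_seq -> Q), tail_hom A theta ->
     (s `<=` A)%classic -> forall x, s x -> theta x = 1].
Proof.
have [k0 [J [B [Bl B1 BJ k04]]]] := base_choice.
pose e : perm_seq := fun k => be (B k); pose u : perm_seq := fun k => bu (B k).
pose v : perm_seq := fun k => bv (B k); pose M k := bM (B k).
have [ge gu gv gM] : [/\ forall k, e k ^+ 2 = 1, forall k, u k ^+ 2 = 1 /\ v k ^+ 2 = 1,
   forall k, [/\ 4 %| #|moved (e k)|, 4 %| #|moved (u k)| & 4 %| #|moved (v k)|]%N &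
   forall k, (9 * M k <= k.+1)%N].
  by split=> k; [exact: be_sq|exact: buv_sq|exact: b4|exact: b_small].
have g1 k : (k < k0)%N -> [/\ e k = 1, u k = 1 & v k = 1] by case/B1.
have M0 k : (k < k0)%N -> M k = 0%N by case/B1.
have ct k : cls (M k) (e k * e k ^ (u k * v k)) by apply: bcls.
have cm k j : (2 <= j <= J k)%N -> commute (e k) (e k ^ ((u k * v k) ^+ j)) by apply: bcomm.
have gen k : exists a b c : {perm 'I_k.+1},
    ((k < k0)%N -> [/\ a = 1, b = 1 & c = 1]) /\ ((k0 <= k)%N ->
    [/\ a ^+ 2 = 1 /\ b ^+ 2 = 1, ~~ odd_perm a, ~~ odd_perm b, cls 1 c &
   forall W : {group {perm 'I_k.+1}}, a \in W -> b \in W -> c \in W -> 'Alt_('I_k.+1) \subset W]).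
  have [kk|kk] := leqP k0 k; last by exists 1, 1, 1; split=> // h; lia.
  have [|a [b [c h]]] := @Alt_generators' k; first by lia.
  by exists a, b, c; split=> // h'; lia.
pose a : perm_seq := fun k => projT1 (cid (gen k)).
pose b : perm_seq := fun k => projT1 (cid (projT2 (cid (gen k)))).
pose c : perm_seq := fun k => projT1 (cid (projT2 (cid (projT2 (cid (gen k)))))).
have habc k : ((k < k0)%N -> [/\ a k = 1, b k = 1 & c k = 1]) /\ ((k0 <= k)%N ->
    [/\ a k ^+ 2 = 1 /\ b k ^+ 2 = 1, ~~ odd_perm (a k), ~~ odd_perm (b k), cls 1 (c k) &
   forall W : {group {perm 'I_k.+1}}, a k \in W -> b k \in W -> c k \in W ->
     'Alt_('I_k.+1) \subset W]).
  exact: (projT2 (cid (projT2 (cid (projT2 (cid (gen k))))))).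
have kinv := killed_involution ge gM Bl M0 ct cm BJ.
have ke : killed k0 e u v e := killed_e ge gv g1 gM Bl M0 ct cm BJ.
have kz : killed k0 e u v (u * v) := killed_z ge gu gv g1 gM Bl M0 ct cm BJ.
have sq1 k : (1 : {perm 'I_k.+1}) ^+ 2 = 1 /\ (4 %| #|moved (1 : {perm 'I_k.+1})|)%N.
  by rewrite expg1n moved1.
have ka : killed k0 e u v a.
  apply: kinv => k; last by case: (habc k) => h _ /h[].
  have [h1 h2] := habc k; have [kk|kk] := leqP k0 k; last by have [-> _ _] := h1 kk; exact: sq1.
  by have [[a2 _] av _ _ _] := h2 kk; split=> //; apply: even_involution_moved.
have kb : killed k0 e u v b.
  apply: kinv => k; last by case: (habc k) => h _ /h[].
  have [h1 h2] := habc k; have [kk|kk] := leqP k0 k; last by have [_ -> _] := h1 kk; exact: sq1.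
  by have [[_ b2] _ bv _ _] := h2 kk; split=> //; apply: even_involution_moved.
have kc : killed k0 e u v c.
  apply: (killed_small ge gM M0 ct cm BJ) => k.
  have [h1 h2] := habc k; have [kk|kk] := leqP k0 k.
    by have [_ _ _ c1 _] := h2 kk; exists 1%N => //; have := Bl k kk; rewrite /M; lia.
  by have [_ _ ->] := h1 kk; exists 0%N => //; exists [::]; rewrite /blk big_nil.
have [s1 [f1 x1 a1 t1]] := ke; have [s2 [f2 x2 a2 t2]] := kz.
have [s3 [f3 x3 a3 t3]] := ka; have [s4 [f4 x4 a4 t4]] := kb.
have [s5 [f5 x5 a5 t5]] := kc.
exists k0, (s1 `|` s2 `|` s3 `|` s4 `|` s5)%classic; split=> //.
- by rewrite !finite_setU.
- by move=> x [[[[]|]|]|]; [exact: a1|exact: a2|exact: a3|exact: a4|exact: a5].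
- move=> k W kk sW; have [_ h2] := habc k; have [_ _ _ _] := h2 kk; apply; apply: sW.
  + by left; left; right.
  + by left; right.
  + by right.
move=> A Q th tth sA.
have Ae : A e by apply: sA; do 4 left.
have Az : A (u * v) by apply: sA; do 3 left; right.
move=> x [[[[]|]|]|]; [apply: (t1 A)|apply: (t2 A)|apply: (t3 A)|apply: (t4 A)|apply: (t5 A)] => //.
- by move=> y ?; apply: sA; do 4 left.
- by move=> y ?; apply: sA; do 3 left; right.
- by move=> y ?; apply: sA; do 2 left; right.
- by move=> y ?; apply: sA; left; right.
- by move=> y ?; apply: sA; right.
Qed.

(** * Subgroups of a product of alternating groups *)

Section Generated.
Variable G : groupType.
Implicit Types (S H : set G).

Lemma smallest_subgroup S : is_subgroup (smallest (@is_subgroup G) S).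
Proof.
split.
- by move=> H [[H1 _ _] _].
- by move=> x y Sx Sy H hH; have [[H1 HM HV] SH] := hH; apply: HM; [exact: Sx|exact: Sy].
- by move=> x Sx H hH; have [[H1 HM HV] SH] := hH; apply: HV; exact: Sx.
Qed.

End Generated.

(** * Finitely supported elements and truncations *)

Section Deltas.
Variable T : nat -> groupType.
Implicit Types x y : cartesian_prod T.

Definition delta k (a : T k) : cartesian_prod T := @eqtype.dfwith nat T (1 : cartesian_prod T) k a.

Lemma delta_in k (a : T k) : delta a k = a.
Proof. exact: eqtype.dfwith_in. Qed.

Lemma delta_out k (a : T k) j : k != j -> delta a j = 1.
Proof. by move=> kj; rewrite /delta eqtype.dfwith_out. Qed.

Lemma deltaP k (x : cartesian_prod T) : (forall j, k != j -> x j = 1) -> x = delta (x k).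
Proof.
move=> h; apply: cprodP => j; have [<-|kj] := eqVneq k j; first by rewrite delta_in.
by rewrite delta_out // h.
Qed.

Lemma deltaM k (a b : T k) : delta (a * b) = delta a * delta b.
Proof.
apply: cprodP => j; rewrite cprodM; have [<-|kj] := eqVneq k j; first by rewrite !delta_in.
by rewrite !delta_out // mulg1.
Qed.

Lemma delta1 k : delta (1 : T k) = 1.
Proof. by apply: (mulgI (delta (1 : T k))); rewrite -deltaM !mulg1. Qed.

Definition trunc N x : cartesian_prod T := fun k => if (k < N)%N then 1 else x k.
Definition cprod_head N x : cartesian_prod T := fun k => if (k < N)%N then x k else 1.

Lemma truncM N x y : trunc N (x * y) = trunc N x * trunc N y.
Proof. by apply: cprodP => k; rewrite cprodM /trunc; case: ifP => // _; rewrite mulg1. Qed.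

Lemma headM N x y : cprod_head N (x * y) = cprod_head N x * cprod_head N y.
Proof. by apply: cprodP => k; rewrite cprodM /cprod_head; case: ifP => // _; rewrite mulg1. Qed.

Lemma trunc_id N x : (forall k, (k < N)%N -> x k = 1) -> trunc N x = x.
Proof. by move=> h; apply: cprodP => k; rewrite /trunc; case: ifP => // /h ->. Qed.

Lemma head_trunc N x : x = cprod_head N x * trunc N x.
Proof. by apply: cprodP => k; rewrite cprodM /trunc /cprod_head; case: ifP; rewrite ?mulg1 ?mul1g. Qed.

Lemma head_subgroup N x (A : set (cartesian_prod T)) : is_subgroup A ->
  (forall k, (k < N)%N -> A (delta (x k))) -> A (cprod_head N x).
Proof.
move=> [A1 AM AV]; elim: N => [|N IH] h; first by rewrite (_ : cprod_head 0 x = 1).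
have -> : cprod_head N.+1 x = cprod_head N x * delta (x N).
  apply: cprodP => k; rewrite cprodM /cprod_head; have [<-|kj] := eqVneq N k.
    by rewrite ltnn ltnSn delta_in mul1g.
  by rewrite delta_out // mulg1 ltnS leq_eqVlt eq_sym (negPf kj).
by apply: AM; [apply: IH => k kN; apply: h; rewrite ltnS ltnW|apply: h].
Qed.

Lemma trunc_subgroup N x (A : set (cartesian_prod T)) : is_subgroup A -> A x ->
  (forall k, (k < N)%N -> A (delta (x k))) -> A (trunc N x).
Proof.
move=> sA Ax h; have Ah := head_subgroup sA h; have [A1 AM AV] := sA.
have -> : trunc N x = (cprod_head N x)^-1 * x by rewrite {3}(head_trunc N x) mulKg.
by apply: AM => //; apply: AV.
Qed.

End Deltas.

Lemma pigeonhole_unbounded (Q : Type) (P : nat -> Prop) (g : nat -> Q) :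
  (forall N, exists k, (N <= k)%N /\ P k) -> finite_set [set: Q]%classic ->
  exists m n, [/\ (m < n)%N, P m /\ P n & g m = g n].
Proof.
move=> /choice[f hf] fQ; pose nu i := iter i (fun k => f k.+1) (f 0%N).
have Pnu i : P (nu i) by case: i => [|i]; [case: (hf 0%N)|case: (hf (nu i).+1)].
have nuS i : (nu i < nu i.+1)%N by case: (hf (nu i).+1).
have [m [n [mn e]]] := pigeonhole (fun i => g (nu i)) fQ.
exists (nu m), (nu n); split=> //.
elim: n mn {e} => // n IH; rewrite ltnS leq_eqVlt => /orP[/eqP -> //|/IH h].
exact: ltn_trans h (nuS n).
Qed.

Lemma simple_Alt k : (4 <= k)%N -> simple 'Alt_('I_k.+1).
Proof. by move=> k4; apply: simple_Alt5; rewrite card_ord. Qed.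

Lemma Alt_noncommuting k : (4 <= k)%N -> exists a b : {perm 'I_k.+1},
  [/\ a \in 'Alt_('I_k.+1), b \in 'Alt_('I_k.+1) & [~ a, b] != 1].
Proof.
move=> k4; apply: contrapT => h.
have : solvable 'Alt_('I_k.+1) = false by apply: solvable_AltF; rewrite card_ord.
suff ab : abelian 'Alt_('I_k.+1) by rewrite abelian_sol.
apply/centsP => a aA b bA; apply/commgP; apply/negPn/negP => n; apply: h.
by exists a, b; split.
Qed.

(** * The group generated by a perfect family contains the finitely supported sequences *)

Section Subdirect.
Variables (k0 : nat) (s : set perm_seq).
Hypothesis k04 : (4 <= k0)%N.
Hypothesis s_alt : forall x, s x -> alt_seq k0 x.
Hypothesis s_gen : forall k (W : {group {perm 'I_k.+1}}), (k0 <= k)%N ->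
     (forall x, s x -> x k \in W) -> 'Alt_('I_k.+1) \subset W.
Hypothesis s_perfect : forall A (Q : groupType) (theta : perm_seq -> Q), tail_hom A theta ->
     (s `<=` A)%classic -> forall x, s x -> theta x = 1.

Let A0 := smallest (@is_subgroup perm_seq) s.

Lemma A0_subgroup : is_subgroup A0. Proof. exact: smallest_subgroup. Qed.

Lemma A0_ind (B : set perm_seq) : is_subgroup B -> (s `<=` B)%classic -> (A0 `<=` B)%classic.
Proof. exact: smallest_sub. Qed.

Lemma s_A0 : (s `<=` A0)%classic. Proof. exact: sub_gen_smallest. Qed.

Lemma A0_alt x : A0 x -> alt_seq k0 x.
Proof.
apply: A0_ind => //; split.
- by move=> k; rewrite cprod1 group1.
- move=> {}x y xa ya k; have [x1 x2] := xa k; have [y1 y2] := ya k.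
  by rewrite cprodM groupM //; split=> // kk; rewrite x2 // y2 // mulg1.
- move=> {}x xa k; have [x1 x2] := xa k.
  by rewrite cprodV groupV; split=> // kk; rewrite x2 // invg1.
Qed.

Definition img (B : set perm_seq) k : {set {perm 'I_k.+1}} :=
  [set a | `[< exists2 x : perm_seq, B x & x k = a >]].

Lemma imgP B k a : reflect (exists2 x : perm_seq, B x & x k = a) (a \in img B k).
Proof. by rewrite inE; apply: asboolP. Qed.

Lemma img_group_set B k : is_subgroup B -> group_set (img B k).
Proof.
move=> [B1 BM BV]; apply/group_setP; split; first by apply/imgP; exists (1 : perm_seq).
move=> a b /imgP[x Bx <-] /imgP[y By <-]; apply/imgP; exists (x * y) => //.
exact: BM.
Qed.

Lemma A0_onto k a : (k0 <= k)%N -> a \in 'Alt_('I_k.+1) -> exists2 x : perm_seq, A0 x & x k = a.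
Proof.
move=> kk aA; apply/imgP.
have := @s_gen k (Group (img_group_set k A0_subgroup)) kk; move/(_ _)/fintype.subsetP; apply=> //.
by move=> x sx; apply/imgP; exists x => //; apply: s_A0.
Qed.

Definition nsub (B : set perm_seq) :=
  [/\ is_subgroup B, (B `<=` A0)%classic & forall x y, B x -> A0 y -> B (x ^ y)].

Definition full k (B : set perm_seq) := exists2 x : perm_seq, B x & x k != 1.

(** The projection of [B] is normal in Alt(k + 1), because [A0] projects onto that group; by
    simplicity a nontrivial projection is everything. *)
Lemma full_onto k B a : (k0 <= k)%N -> nsub B -> full k B -> a \in 'Alt_('I_k.+1) ->
  exists2 x : perm_seq, B x & x k = a.
Proof.
move=> kk [sB BA Bn] [x Bx xk] aA; apply/imgP.
pose I := Group (img_group_set k sB).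
have /simpleP[_ /(_ I)] := simple_Alt (leq_trans k04 kk).
case.
- apply/andP; split.
    by apply/fintype.subsetP => _ /imgP[y By <-]; have [] := A0_alt (BA _ By) k.
  apply/fintype.subsetP => b bA; rewrite inE.
  apply/fintype.subsetP => _ /imsetP[_ /imgP[y By <-] ->].
  have [w Aw <-] := A0_onto kk bA; apply/imgP.
  by exists (y ^ w); first exact: Bn.
- move=> I1; move: xk; have : x k \in img B k by apply/imgP; exists x.
  by rewrite [img B k]I1 => /set1P ->; rewrite eqxx.
- by move=> eI; rewrite [img B k]eI.
Qed.

(** Commutators of elements of [B] with elements of [B'] lie in both normal subgroups. Since both
    project onto a nonabelian group, some commutator is nontrivial at [k]. *)
Lemma full_setI k B B' : (k0 <= k)%N -> nsub B -> nsub B' -> full k B -> full k B' ->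
  full k (B `&` B')%classic.
Proof.
move=> kk nB nB' fB fB'; have [a [b [aA bA ab]]] := Alt_noncommuting (leq_trans k04 kk).
have [x Bx xa] := full_onto kk nB fB aA; have [y By yb] := full_onto kk nB' fB' bA.
have [[_ BM BV] BA Bn] := nB; have [[_ BM' BV'] BA' Bn'] := nB'.
exists [~ x, y]; last by rewrite -xa -yb in ab.
split; rewrite /commg.
  by apply: BM; [apply: BV|apply: Bn => //; apply: BA'].
have -> : x^-1 * x ^ y = (y^-1) ^ x * y by rewrite /conjg !mulgA.
by apply: (BM') => //; apply: (Bn'); [exact: BV'|exact: BA].
Qed.

Lemma nsub_setI B B' : nsub B -> nsub B' -> nsub (B `&` B')%classic.
Proof.
move=> [[B1 BM BV] BA Bn] [[B1' BM' BV'] BA' Bn']; split; first split.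
- by [].
- by move=> x y [x1 x2] [y1 y2]; split; [apply: BM|apply: BM'].
- by move=> x [x1 x2]; split; [apply: BV|apply: BV'].
- by move=> x [x1 _]; apply: BA.
- by move=> x y [x1 x2] Ay; split; [apply: Bn|apply: Bn'].
Qed.

Definition ker_on (P : nat -> Prop) : set perm_seq :=
  [set x | A0 x /\ forall j, P j -> x j = 1]%classic.

Lemma nsub_ker_on P : nsub (ker_on P).
Proof.
have [A1 AM AV] := A0_subgroup; split; first split.
- by split.
- move=> x y [x1 x2] [y1 y2]; split; first exact: AM.
  by move=> j Pj; rewrite cprodM x2 // y2 // mulg1.
- move=> x [x1 x2]; split; first exact: AV.
  by move=> j Pj; rewrite cprodV x2 // invg1.
- by move=> x [].
move=> x y [x1 x2] Ay; split; first by apply: (AM) => //; [exact: AV|exact: AM].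
by move=> j Pj; rewrite cprodJ x2 // conj1g.
Qed.

Lemma card_Alt_lt j k : (4 <= k)%N -> (#|'Alt_('I_k.+1)| <= #|'Alt_('I_j.+1)|)%N -> (k <= j)%N.
Proof.
move=> k4; apply: contraTT; rewrite -!ltnNge => jk.
have h1 : (#|'Alt_('I_j.+1)| <= k`!)%N.
  apply: leq_trans (subset_leq_card (Alt_subset _)) _.
  by rewrite card_Sym card_ord leq_fact.
apply: leq_ltn_trans h1 _; rewrite -(ltn_pmul2l (isT : 0 < 2)).
rewrite card_Alt card_ord; last by lia.
by rewrite factS ltn_pmul2r ?fact_gt0 //; lia.
Qed.

(** If the kernel of coordinate [j] is trivial at [k], then coordinate [j] determines coordinate [k]
    on [A0]. Lifting elements of Alt(k + 1) to [A0] and reading them at [j] is then injective, and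
    orders can be compared. *)
Lemma coordinate_le k j : (k0 <= k)%N -> ~ full k (ker_on (fun i => i = j)) -> (k <= j)%N.
Proof.
move=> kk nf; have [A1 AM AV] := A0_subgroup.
have h x : A0 x -> x j = 1 -> x k = 1.
  move=> Ax xj; apply/eqP/negPn/negP => xk; apply: nf; exists x => //.
  by split=> // _ ->.
apply: card_Alt_lt (leq_trans k04 kk) _.
have ex (a : {perm 'I_k.+1}) : exists x : perm_seq, a \in 'Alt_('I_k.+1) -> A0 x /\ x k = a.
  have [aA|] := boolP (a \in 'Alt_('I_k.+1)); last by exists (1 : perm_seq).
  by have [x Ax xa] := A0_onto kk aA; exists x.
pose F a := projT1 (cid (ex a)) j.
have FP a : a \in 'Alt_('I_k.+1) -> exists x : perm_seq, [/\ A0 x, x k = a & x j = F a].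
  by move=> aA; have [] := projT2 (cid (ex a)) aA; exists (projT1 (cid (ex a))).
rewrite -(@card_in_imset _ _ F).
  apply: subset_leq_card; apply/fintype.subsetP => _ /imsetP[a aA ->].
  by have [x [Ax _ <-]] := FP _ aA; have [] := A0_alt Ax j.
move=> a b aA bA; have [x [Ax <- <-]] := FP _ aA; have [y [Ay <- <-]] := FP _ bA => xy.
have := h (x^-1 * y); rewrite !cprodM !cprodV xy mulVg => /(_ _ erefl) e.
by apply: (mulgI (x k)^-1); rewrite mulVg e //; apply: (AM) => //; apply: AV.
Qed.

(** A Goursat argument. Otherwise [k <= j], and as [j != k] the kernel of coordinate [k] must be
    full at [j]. So any [y] in [A0] can be corrected to be trivial at [j] without changing its
    coordinate [k]. *)
Lemma full_ker1 k j : (k0 <= k)%N -> j != k -> full k (ker_on (fun i => i = j)).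
Proof.
move=> kk jk; apply: contrapT => nf; have kj := coordinate_le kk nf.
have [A1 AM AV] := A0_subgroup.
have kj' : (k0 <= j)%N by apply: leq_trans kk kj.
have [fj|nfj] := pselect (full j (ker_on (fun i => i = k))); last first.
  by have := coordinate_le kj' nfj => jk'; move: jk; rewrite eqn_leq jk' kj.
have [a [b [aA bA ab]]] := Alt_noncommuting (leq_trans k04 kk).
have [y Ay ya] := A0_onto kk aA; have yj : y j \in 'Alt_('I_j.+1) by have [] := A0_alt Ay j.
have [x [Ax xk] xj] := full_onto kj' (nsub_ker_on _) fj yj.
apply: nf; exists (x^-1 * y).
  split; first by apply: (AM) => //; apply: AV.
  by move=> _ ->; rewrite cprodM cprodV xj mulVg.
rewrite cprodM cprodV xk // invg1 mul1g ya; apply: contraNneq ab => ->.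
by rewrite comm1g.
Qed.

(** Otherwise every finitely supported element of [A0] is trivial at [k], so evaluation at [k] is a
    [tail_hom] to a finite group. It would kill [s], contrary to [s_gen]. *)
Lemma full_tail k : (k0 <= k)%N -> exists N, full k (ker_on (fun i => (N <= i)%N)).
Proof.
move=> kk; apply: contrapT => nf.
have th : tail_hom A0 (fun x : perm_seq => x k).
  split=> //; [exact: A0_subgroup|exact: finite_finset|].
  move=> x Ax [N hN]; apply/eqP/negPn/negP => xk; apply: nf; exists N, x => //.
have [a [b [aA bA ab]]] := Alt_noncommuting (leq_trans k04 kk).
have := @s_gen k (1%G : {group {perm 'I_k.+1}}) kk.
move=> /(_ _)/fintype.subsetP/(_ _ aA)/set1P ea.
move: ab; rewrite ea ?comm1g ?eqxx // => x sx; apply/set1P.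
exact: (s_perfect th s_A0).
Qed.

Lemma delta_A0 k (a : {perm 'I_k.+1}) : (k0 <= k)%N -> a \in 'Alt_('I_k.+1) ->
  A0 (delta (T := fun k => {perm 'I_k.+1}) a).
Proof.
move=> kk aA; have [N fN] := full_tail kk.
(* Start from elements trivial beyond [N] and impose triviality at one further coordinate at a time;
   the elements of [B N] are supported on [k] alone. *)
pose B m := (ker_on (fun i => (N <= i)%N) `&` ker_on (fun i => (i < m)%N /\ i != k))%classic.
have nB m : nsub (B m) by apply: nsub_setI; apply: nsub_ker_on.
have fB m : full k (B m).
  elim: m => [|m IH].
    by have [x [Ax xN] xk] := fN; exists x => //; split; split=> // j [].
  have [mk|mk] := eqVneq m k.
    have [x [[Ax xN] [_ xm]] xk] := IH; exists x => //; split; split=> // j [jm jk].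
    by apply: xm; split=> //; move: jm; rewrite ltnS leq_eqVlt {1}mk (negPf jk).
  have := full_setI kk (nB m) (nsub_ker_on _) IH (full_ker1 kk mk).
  case=> x [[[Ax xN] [_ xm]] [_ xm']] xk; exists x => //; split; split=> // j [jm jk].
  move: jm; rewrite ltnS leq_eqVlt => /orP[/eqP ->|jm]; first exact: xm'.
  exact: xm.
have [x [[Ax xN] [_ xm]] xk] := full_onto kk (nB N) (fB N) aA.
rewrite -xk -(deltaP (x := x)) // => j kj; have [jN|jN] := leqP N j; first exact: xN.
by apply: xm; rewrite eq_sym.
Qed.

(** * Finite images of the group [A0] *)

Section FiniteImage.
Variables (Q : groupType) (theta : perm_seq -> Q).
Hypotheses (fQ : finite_set [set: Q]%classic) (th : hom_on A0 theta).

Local Notation dl a := (delta (T := fun k => {perm 'I_k.+1}) a).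

(** The part of the kernel supported on [k] is normal in [A0] and nontrivial at [k], hence is the
    whole factor. *)
Lemma delta_killed k (c : {perm 'I_k.+1}) : (k0 <= k)%N -> c \in 'Alt_('I_k.+1) -> c != 1 ->
  theta (dl c) = 1 -> forall a, a \in 'Alt_('I_k.+1) -> theta (dl a) = 1.
Proof.
move=> kk cA c1 tc a aA; have [[A1 AM AV] tM] := th.
pose B := [set x | A0 x /\ theta x = 1]%classic; have sB : is_subgroup B by apply: hom_on_ker.
pose C := (B `&` ker_on (fun j => j != k))%classic.
have nC : nsub C.
  have [[C1 CM CV] CA Cn] := nsub_ker_on (fun j => j != k); have [B1 BM BV] := sB.
  split; first split.
  - by split.
  - by move=> x y [x1 x2] [y1 y2]; split; [exact: BM|exact: CM].
  - by move=> x [x1 x2]; split; [exact: BV|exact: CV].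
  - by move=> x [_ x2]; apply: CA.
  move=> x y [[Ax x1] x2] Ay; split; last exact: Cn.
  split; first by case: (Cn _ _ x2 Ay).
  by have [_ ->] := hom_onJ th Ax Ay; rewrite x1 conj1g.
have fC : full k C.
  exists (dl c); last by rewrite delta_in.
  split; split; rewrite ?tc //; try exact: delta_A0.
  by move=> j jk; rewrite delta_out // eq_sym.
have [x [[Ax tx] [_ xk]] xa] := full_onto kk nC fC aA.
by rewrite -xa -(deltaP (x := x)) // => j kj; apply: xk; rewrite eq_sym.
Qed.

(** If infinitely many factors survived, two of them, [m < n], would contain noncentral elements
    with equal images. Their quotient [w] lies in the kernel, and its commutator with an element of
    factor [n] is a nontrivial kernel element inside that factor, which contradicts
    [delta_killed]. *)
Lemma deltas_killed : exists N, (k0 <= N)%N /\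
  forall k (a : {perm 'I_k.+1}), (N <= k)%N -> a \in 'Alt_('I_k.+1) -> theta (dl a) = 1.
Proof.
have [[A1 AM AV] tM] := th.
pose bad k := (k0 <= k)%N /\ exists2 a : {perm 'I_k.+1}, a \in 'Alt_('I_k.+1) & theta (dl a) <> 1.
have [[N hN]|nb] := pselect (exists N, forall k, (N <= k)%N -> ~ bad k).
  exists (maxn k0 N); rewrite leq_maxl; split=> // k a; rewrite geq_max => /andP[k1 k2] aA.
  by apply: contrapT => h; apply: (hN k k2); split=> //; exists a.
have ub N : exists k, (N <= k)%N /\ bad k.
  by apply: contrapT => h; apply: nb; exists N => k Nk bk; apply: h; exists k.
have ab k : exists ab : {perm 'I_k.+1} * {perm 'I_k.+1}, (k0 <= k)%N ->
    [/\ ab.1 \in 'Alt_('I_k.+1), ab.2 \in 'Alt_('I_k.+1) & [~ ab.1, ab.2] != 1].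
  have [kk|kk] := leqP k0 k; last by exists (1, 1).
  by have [a [b h]] := Alt_noncommuting (leq_trans k04 kk); exists (a, b).
pose f k := projT1 (cid (ab k)).
have hf k : (k0 <= k)%N ->
    [/\ (f k).1 \in 'Alt_('I_k.+1), (f k).2 \in 'Alt_('I_k.+1) & [~ (f k).1, (f k).2] != 1].
  exact: (projT2 (cid (ab k))).
have [m [n [mn [bm bn] e]]] := pigeonhole_unbounded (fun k => theta (dl (f k).1)) ub fQ.
have [[mm _] [nn [a aA ta]]] := (bm, bn).
have [fm1 _ _] := hf m mm; have [fn1 fn2 fn] := hf n nn.
case: ta; apply: (delta_killed nn _ fn) => //.
  by rewrite groupR.
have Am := delta_A0 mm fm1; have An := delta_A0 nn fn1; have An2 := delta_A0 nn fn2.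
pose w := (dl (f m).1)^-1 * dl (f n).1.
have Aw : A0 w by apply: (AM) => //; apply: (AV).
have tw : theta w = 1 by rewrite /w tM ?(hom_onV th) //; [rewrite e mulVg|apply: (AV)].
have -> : dl [~ (f n).1, (f n).2] = w^-1 * w ^ dl (f n).2.
  apply: cprodP => j; rewrite cprodM cprodV cprodJ /w cprodM cprodV.
  have [<-|nj] := eqVneq n j; first by rewrite !delta_in !delta_out ?(ltn_eqF mn) // invg1 mul1g.
  by rewrite !(delta_out _ nj) mulg1 conjg1 mulVg.
have [Awj twj] := hom_onJ th Aw An2.
by rewrite tM //; [rewrite (hom_onV th) // twj tw conj1g invg1 mulg1|apply: (AV)].
Qed.

Lemma trunc_A0 N x : A0 x -> A0 (trunc N x).
Proof.
move=> Ax; apply: trunc_subgroup => //; first exact: A0_subgroup.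
move=> k _; have [x1 x2] := A0_alt Ax k; have [kk|kk] := leqP k0 k; first exact: delta_A0.
by rewrite x2 // delta1; case: A0_subgroup.
Qed.

(** With [N] from [deltas_killed], the composite of [theta] and [trunc N] kills every finitely
    supported element. It is therefore a [tail_hom], so it kills the generators [s] and all of
    [A0]. *)
Lemma tails_killed : exists N, forall x, A0 x -> (forall k, (k < N)%N -> x k = 1) -> theta x = 1.
Proof.
have [N [kN dN]] := deltas_killed; exists N.
have [sA tM] := th; pose theta' x := theta (trunc N x).
have th' : hom_on A0 theta'.
  by split=> // x y Ax Ay; rewrite /theta' truncM tM //; apply: trunc_A0.
have tl : tail_hom A0 theta'.
  split=> //; first by case: th'.
  move=> x Ax [M xM].
  have -> : theta' x = theta (cprod_head M (trunc N x)).
    rewrite /theta'; congr theta; apply: cprodP => k; rewrite /cprod_head /trunc.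
    by case: (ltnP k M) => // /xM ->; rewrite if_same.
  have := @head_subgroup _ M (trunc N x) _ (hom_on_ker th); case=> // k _.
  have [x1 x2] := A0_alt Ax k; rewrite /trunc; case: ltnP => Nk.
    by rewrite delta1; have [K1 _ _] := hom_on_ker th.
  by split; [apply: delta_A0 => //; apply: leq_trans Nk|apply: dN].
have kills : (A0 `<=` [set x | A0 x /\ theta' x = 1])%classic.
  apply: A0_ind; first exact: hom_on_ker.
  by move=> x sx; split; [exact: s_A0|apply: (s_perfect tl s_A0)].
by move=> x Ax xN; have [_] := kills x Ax; rewrite /theta' trunc_id.
Qed.

End FiniteImage.

End Subdirect.

(** * Profinite completions of subgroups of a product *)

Section ProfiniteCompletion.
Local Open Scope classical_set_scope.
Local Open Scope quotient_scope.
Local Open Scope group_scope.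

Section ProductTopology.
Variables (I : Type) (T : I -> groupType).

Lemma cprod_coordinate_nbhs (x : cartesian_prod T) i :
  nbhs x [set y : cartesian_prod T | y i = x i]%classic.
Proof.
have /cvg_sup/(_ i) : nbhs x --> x by [].
apply; exists [set y : cartesian_prod T | y i = x i]%classic => //; split => //.
exists [set x i]%classic => //; exact: (@discrete_open (discrete_topology (T i))).
Qed.

(** The factors are discrete, so continuity amounts to each coordinate being locally constant. *)
Lemma cprod_continuous (X : topologicalType) (f : X -> cartesian_prod T) :
  (forall x i, nbhs x [set y | f y i = f x i]%classic) -> continuous f.
Proof.
move=> h x; apply/cvg_sup => i U [V /= [[W oW <-] Wfx] sU].
by apply: filterS (h x i) => y /= e; apply: sU; rewrite /= e.
Qed.

End ProductTopology.

Section SubgroupType.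
Variables (P : groupType) (H : set P).

(** The proof of [is_subgroup H] is an argument of the type so that the group structure can be
    inferred from it. *)
Definition subgroup_type of is_subgroup H : Type := H.

Variable sH : is_subgroup H.

Lemma subgroup_group_closed : group_closed [in H].
Proof.
have [H1 HM HV] := sH; split=> [|x y]; rewrite !inE //.
by move=> Hx Hy; apply: HM => //; apply: HV.
Qed.

HB.instance Definition _ := SubChoice.on (subgroup_type sH).
HB.instance Definition _ := SubChoice_isSubGroup.Build _ _ (subgroup_type sH)
  subgroup_group_closed.

Definition subval (x : subgroup_type sH) : P := val x.

Lemma subval_inj : injective subval. Proof. exact: val_inj. Qed.

Definition in_subgroup (x : P) (Hx : H x) : subgroup_type sH :=
  exist _ x (mem_set Hx).

Lemma subvalP (x : subgroup_type sH) : H (subval x).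
Proof. by apply: set_mem; exact: (valP x). Qed.

Lemma subvalM (x y : subgroup_type sH) : subval (x * y) = subval x * subval y.
Proof. by []. Qed.

Lemma subvalV (x : subgroup_type sH) : subval x^-1 = (subval x)^-1.
Proof. by apply: (mulgI (subval x)); rewrite -subvalM !mulgV. Qed.

End SubgroupType.

Lemma subgroup_finitely_generated (P : groupType) (S : set P) : finite_set S ->
  finitely_generated (subgroup_type (smallest_subgroup S)).
Proof.
move=> fS; pose sS := smallest_subgroup S.
exists [set x : subgroup_type sS | S (subval x)]; last first.
  apply/seteqP; split=> // x _ B [sB SB]; have [B1 BM BV] := sB.
  suff : smallest (@is_subgroup P) S `<=` [set y | exists2 z : subgroup_type sS, B z & subval z = y].
    by move=> /(_ _ (subvalP x))[z Bz /subval_inj <-].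
  apply: smallest_sub.
    split.
    - exists (1 : subgroup_type sS) => //.
    - by move=> _ _ [z Bz <-] [w Bw <-]; exists (z * w) => //; apply: BM.
    - by move=> _ [z Bz <-]; exists z^-1; [apply: BV|rewrite subvalV].
  move=> y Sy; exists (in_subgroup sS (sub_gen_smallest Sy)) => //.
  by apply: SB.
apply: (@finite_preimage _ _ S (fun x : subgroup_type sS => subval x)) fS => x y _ _.
exact: subval_inj.
Qed.

Lemma quot_finite (G : groupType) (N : fin_normal G) : finite_set [set: quot N].
Proof.
have fr := fin_normal_index N.
pose F (a : quot N) := left_coset N (repr a).
have -> : [set: quot N] = F @^-1` range (left_coset N).
  by apply/seteqP; split=> // a _; exists (repr a).
apply: finite_preimage fr => a b _ _ /= e; have [N1 NM NV] := fin_normal_subgroup N.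
rewrite -[a]reprK -[b]reprK; apply/quot_eqP.
have : F a (repr b) by rewrite e; exists 1; rewrite ?mulg1.
by case=> y Ny <-; rewrite mulKg.
Qed.

(** * Subgroups containing every factor, all of whose finite quotients see finitely many
    coordinates *)

Section Completion.
Variable T : nat -> groupType.
Hypothesis T_fin : forall k, finite_set [set: T k].
Variable H : set (cartesian_prod T).
Hypothesis sH : is_subgroup H.
Hypothesis H_delta : forall k (a : T k), H (delta a).
Local Notation G := (subgroup_type sH).
Hypothesis H_tail : forall N : fin_normal G, exists n : nat, forall x : G,
  (forall k, (k < n)%N -> subval x k = 1) -> (N : set G) x.

Definition hd n (c : cartesian_prod T) : G :=
  in_subgroup sH (@head_subgroup T n c H sH (fun k _ => H_delta (c k))).

Lemma val_hd n c : subval (hd n c) = cprod_head n c. Proof. by []. Qed.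

Lemma hdM n c c' : hd n (c * c') = hd n c * hd n c'.
Proof. by apply: subval_inj; rewrite subvalM !val_hd headM. Qed.

Definition bound (N : fin_normal G) : nat := projT1 (cid (H_tail N)).

Lemma boundP (N : fin_normal G) (x : G) :
  (forall k, (k < bound N)%N -> subval x k = 1) -> (N : set G) x.
Proof. exact: (projT2 (cid (H_tail N))). Qed.

Lemma pi_eq (N : fin_normal G) (x y : G) :
  (forall k, (k < bound N)%N -> subval x k = subval y k) -> \pi_(quot N) x = \pi_(quot N) y.
Proof.
move=> h; apply/quot_eqP/boundP => k kb.
by rewrite subvalM subvalV cprodM cprodV h // mulVg.
Qed.

Lemma pi_sub (N M : fin_normal G) (x y : G) : N `<=` M ->
  \pi_(quot N) x = \pi_(quot N) y -> \pi_(quot M) x = \pi_(quot M) y.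
Proof. by move=> NM /quot_eqP h; apply/quot_eqP/NM. Qed.

Lemma pi_hd (N : fin_normal G) n c : (bound N <= n)%N ->
  \pi_(quot N) (hd n c) = \pi_(quot N) (hd (bound N) c).
Proof.
move=> le_n; apply: pi_eq => k kb.
by rewrite !val_hd /cprod_head kb (leq_trans kb le_n).
Qed.

(** Modulo [N] only the coordinates below [bound N] count, so a head of that length stands for [c]
    in the quotient by [N]. *)
Definition to_fun (c : cartesian_prod T) : cartesian_prod (fun N : fin_normal G => quot N) :=
  fun N => \pi_(quot N) (hd (bound N) c).

Lemma to_fun_compatible c : compatible (to_fun c).
Proof.
move=> N M NM; rewrite /to_fun quot_proj_pi //.
rewrite -(pi_hd c (leq_maxr (bound N) (bound M))).
by apply: (pi_sub NM); rewrite -(pi_hd c (leq_maxl (bound N) (bound M))).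
Qed.

Definition to_completion (c : cartesian_prod T) : profinite_completion G :=
  exist _ (to_fun c) (mem_set (to_fun_compatible c)).

Lemma to_completionM : {morph to_completion : x y / x * y}.
Proof.
move=> c c'; apply: val_inj; apply: cprodP => N /=.
by rewrite /to_fun hdM -quot_piM.
Qed.

Definition tail_set n : set G := [set x : subgroup_type sH | forall k, (k < n)%N -> subval x k = 1].

Lemma tail_subgroup n : is_subgroup (tail_set n).
Proof.
split=> // [x y hx hy k kn|x hx k kn].
  by rewrite subvalM cprodM hx // hy // mulg1.
by rewrite subvalV cprodV hx // invg1.
Qed.

Lemma tail_normal n : is_normal (tail_set n).
Proof.
move=> x y hx k kn; rewrite /conjg !subvalM subvalV !cprodM hx //.
by rewrite mul1g cprodV mulVg.
Qed.

Lemma finite_heads n : finite_set (range (@cprod_head T n)).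
Proof.
elim: n => [|n IH].
  apply: (sub_finite_set _ (finite_set1 (1 : cartesian_prod T))).
  by move=> _ [c _ <-] /=; apply: cprodP => k.
apply: (sub_finite_set _ (finite_image2 (fun a (b : T n) => a * delta b) IH (T_fin n))).
move=> _ [c _ <-]; exists (cprod_head n c); first by exists c.
exists (c n) => //; apply: cprodP => k; rewrite cprodM /cprod_head.
have [<-|nk] := eqVneq n k; first by rewrite ltnn ltnSn delta_in mul1g.
by rewrite delta_out // mulg1 ltnS [in RHS]leq_eqVlt eq_sym (negPf nk).
Qed.

Lemma tail_index n : finite_index (tail_set n).
Proof.
apply: (sub_finite_set _ (finite_image
  (fun h : cartesian_prod T => [set y : G | cprod_head n (subval y) = h]) (finite_heads n))).
move=> _ [x _ <-]; exists (cprod_head n (subval x)); first by exists (subval x).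
apply/seteqP; split=> y /=.
  move=> e; exists (x^-1 * y); last by rewrite mulKVg.
  move=> k kn; rewrite subvalM subvalV cprodM cprodV.
  by move: (congr1 (fun c : cartesian_prod T => c k) e); rewrite /cprod_head kn => ->; rewrite mulVg.
case=> z hz <-; apply: cprodP => k; rewrite /cprod_head; case: ifP => // kn.
by rewrite subvalM cprodM hz // mulg1.
Qed.

(** By [boundP] these subgroups are cofinal among the normal subgroups of finite index. *)
Definition tailN n : fin_normal G :=
  FinNormal (@tail_subgroup n) (@tail_normal n) (@tail_index n).

Lemma tailN_eq n (x y : G) k : (k < n)%N -> \pi_(quot (tailN n)) x = \pi_(quot (tailN n)) y ->
  subval x k = subval y k.
Proof.
move=> kn /quot_eqP/(_ k kn); rewrite subvalM subvalV cprodM cprodV => e.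
by apply: (mulgI (subval x k)^-1); rewrite mulVg.
Qed.

Lemma tailN_sub m n : (m <= n)%N -> tailN n `<=` tailN m.
Proof. by move=> mn x hx k km; apply: hx; apply: leq_trans mn. Qed.

(** [tailN k.+1] is the first of these subgroups whose cosets determine coordinate [k], so the
    choice of representative is harmless. *)
Definition of_completion (y : profinite_completion G) : cartesian_prod T :=
  fun k => subval (repr (val y (tailN k.+1))) k.

Lemma to_completionK : cancel to_completion of_completion.
Proof.
move=> c; apply: cprodP => k; rewrite /of_completion /= /to_fun.
set N := tailN k.+1; rewrite -(pi_hd c (leq_maxl (bound N) k.+1)).
rewrite (@tailN_eq k.+1 _ (hd (maxn (bound N) k.+1) c) k) // ?reprK //.
by rewrite val_hd /cprod_head leq_max ltnSn orbT.
Qed.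

Lemma of_completionK : cancel of_completion to_completion.
Proof.
move=> y; apply: val_inj; apply: cprodP => N /=; rewrite /to_fun.
have cy : compatible (val y) by apply: set_mem; exact: (valP y).
set n := bound N; set K := tailN n.
have KN : K `<=` N by move=> x; apply: boundP.
(* A single [z] represents [y] modulo [K], hence by compatibility also modulo [N] and modulo every
   [tailN k.+1] with [k < n]. *)
pose z : G := repr (val y K); have yK : val y K = \pi_(quot K) z by rewrite reprK.
rewrite -(cy K N KN) yK quot_proj_pi //; apply: pi_eq => k kn.
rewrite val_hd /cprod_head kn /of_completion; apply: (@tailN_eq k.+1) => //; rewrite reprK.
have Kk : K `<=` tailN k.+1 by apply: tailN_sub.
by rewrite -(cy K _ Kk) yK quot_proj_pi.
Qed.

Lemma head_nbhs (c : cartesian_prod T) n : nbhs c [set c' | cprod_head n c' = cprod_head n c].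
Proof.
elim: n => [|n IH]; first by apply: filterS filterT => c' _; apply: cprodP => k.
apply: filterS (filterI IH (cprod_coordinate_nbhs c n)) => c' [/= e1 e2].
apply: cprodP => k; rewrite /cprod_head; case: ifP => //; rewrite ltnS leq_eqVlt => /orP[/eqP -> //|kn].
by move: (congr1 (fun c : cartesian_prod T => c k) e1); rewrite /cprod_head kn.
Qed.

(** Each component depends on finitely many coordinates of [c], and these are locally constant. *)
Lemma continuous_to_completion : continuous to_completion.
Proof.
apply: continuous_comp_initial; apply: cprod_continuous => c N.
apply: filterS (head_nbhs c (bound N)) => c' /= e.
by rewrite /to_fun; congr (\pi_(quot N) _); apply: subval_inj.
Qed.

Lemma continuous_of_completion : continuous of_completion.
Proof.
apply: cprod_continuous => y k.
have h := @initial_continuous (profinite_completion G) _ val y _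
   (cprod_coordinate_nbhs (val y) (tailN k.+1)).
have h' : nbhs y [set y' : profinite_completion G | val y' (tailN k.+1) = val y (tailN k.+1)] := h.
apply: filterS h' => y' e.
exact: (congr1 (fun q : quot (tailN k.+1) => (subval (repr q) : cartesian_prod T) k) e).
Qed.

End Completion.

End ProfiniteCompletion.

(** * The completed group *)

Section Frame.
Local Open Scope quotient_scope.
Local Open Scope group_scope.

Variables (d : nat) (T : nat -> finGroupType).
Variable phi : forall k : nat, 'I_d -> {morphism 'Alt_('I_k.+1) >-> T k}.
Hypothesis phi_gen : forall k,
  <<\bigcup_(i < d) (phi k i @* 'Alt_('I_k.+1))>> = [set: T k].

Variables (k0 : nat) (s : set perm_seq).
Hypothesis k04 : (4 <= k0)%N.
Hypothesis s_fin : finite_set s.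
Hypothesis s_alt : forall x, s x -> alt_seq k0 x.
Hypothesis s_gen : forall k (W : {group {perm 'I_k.+1}}), (k0 <= k)%N ->
     (forall x, s x -> x k \in W) -> 'Alt_('I_k.+1) \subset W.
Hypothesis s_perfect : forall A (Q : groupType) (theta : perm_seq -> Q), tail_hom A theta ->
     (s `<=` A)%classic -> forall x, s x -> theta x = 1.

Local Notation A0 := (smallest (@is_subgroup perm_seq) s).
Local Notation TT := (fun k : nat => T k : groupType).
Local Notation C := (cartesian_prod TT).

Definition Phi (i : 'I_d) (x : perm_seq) : C := fun k => phi k i (x k).

Lemma PhiM i x y : alt_seq k0 x -> alt_seq k0 y -> Phi i (x * y) = Phi i x * Phi i y.
Proof.
move=> ax ay; apply: cprodP => k; rewrite cprodM /Phi cprodM morphM //.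
  by case: (ax k).
by case: (ay k).
Qed.

(** The sequences in [s] are trivial below [k0], so the first [k0] factors are added whole; being
    finite, they keep the generating set finite. *)
Definition frame_gens : set C :=
  ((\bigcup_(i in [set: 'I_d]) (Phi i @` s)) `|`
   (\bigcup_(k in `I_k0) range (@delta TT k)))%classic.

Lemma frame_gens_fin : finite_set frame_gens.
Proof.
rewrite /frame_gens finite_setU; split.
  by apply: bigcup_finite => [|i _]; [exact: finite_finset|exact: finite_image].
by apply: bigcup_finite => // k _; apply: finite_image; exact: finite_finset.
Qed.

Local Notation G0 := (smallest (@is_subgroup C) frame_gens).

Let sA0 := A0_subgroup s.
Let sG0 : is_subgroup G0 := smallest_subgroup frame_gens.

Lemma Phi_hom i : hom_on A0 (Phi i).
Proof.
by split=> // x y Ax Ay; apply: PhiM; apply: (A0_alt s_alt).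
Qed.

Lemma Phi_G0 i x : A0 x -> G0 (Phi i x).
Proof.
move=> Ax; suff : (A0 `<=` [set x | A0 x /\ G0 (Phi i x)])%classic by move=> /(_ x Ax)[].
have [A1 AM AV] := sA0; have [G1 GM GV] := sG0; have ph := Phi_hom i.
apply: smallest_sub; last first.
  move=> y sy; split; first exact: sub_gen_smallest.
  by apply: sub_gen_smallest; left; exists i => //; exists y.
split.
- by split; rewrite ?(hom_on1 ph).
- move=> y z [Ay Gy] [Az Gz]; split; first exact: AM.
  by have [_ ->] := ph => //; apply: GM.
- move=> y [Ay Gy]; split; first exact: AV.
  by rewrite (hom_onV ph) //; apply: GV.
Qed.

(** From [k0] on, the elements of [T k] whose [delta] lies in [G0] form a subgroup. It contains the
    images of all [phi k i] by [delta_A0], and these generate [T k]. *)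
Lemma G0_delta k (t : T k) : G0 (@delta TT k t).
Proof.
have [kk|kk] := ltnP k k0.
  by apply: sub_gen_smallest; right; exists k => //; exists t.
have [G1 GM GV] := sG0.
pose D := [set t : T k | `[< G0 (@delta TT k t) >]].
have gD : group_set D.
  apply/group_setP; split; first by rewrite inE asboolE (@delta1 TT k).
  by move=> a b; rewrite !inE ?asboolE (@deltaM TT k a b) => Ga Gb; apply: GM.
suff : [set: T k] \subset Group gD.
  by move=> /fintype.subsetP/(_ t); rewrite !inE ?asboolE; apply.
rewrite -phi_gen gen_subG; apply/bigcupsP => i _.
apply/fintype.subsetP => _ /morphimP[a aA _ ->]; rewrite inE ?asboolE.
have -> : @delta TT k (phi k i a) = Phi i (@delta (fun k => {perm 'I_k.+1}) k a).
  apply: cprodP => j; rewrite /Phi; have [<-|kj] := eqVneq k j; first by rewrite !delta_in.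
  by rewrite !delta_out // morph1.
by apply: Phi_G0; apply: (delta_A0 k04 s_alt s_gen s_perfect kk aA).
Qed.

Local Notation G := (subgroup_type sG0).

(** A total inverse of [subval] with default value 1 off [G0], needed because the homomorphisms on
    [A0] are total functions. *)
Definition ins (w : C) : G := if pselect (G0 w) is left h then in_subgroup sG0 h else 1.

Lemma insE w : G0 w -> subval (ins w) = w.
Proof. by rewrite /ins => Gw; case: pselect. Qed.

Lemma insM w w' : G0 w -> G0 w' -> ins (w * w') = ins w * ins w'.
Proof.
move=> Gw Gw'; apply: subval_inj; rewrite subvalM !insE //.
by have [G1 GM GV] := sG0; apply: GM.
Qed.

Lemma trunc_G0 n w : G0 w -> G0 (trunc n w).
Proof. by move=> Gw; apply: trunc_subgroup => // k _; apply: G0_delta. Qed.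

(** For each [i], composing [Phi i] with the projection to the finite quotient by [N] gives a
    homomorphism on [A0], to which [tails_killed] applies. So the truncations of all generators lie
    in [N], and truncation is a homomorphism on [G0]. *)
Lemma G0_tail (N : fin_normal G) : exists n : nat, forall x : G,
  (forall k, (k < n)%N -> subval x k = 1) -> (N : set G) x.
Proof.
have [N1 NM NV] := fin_normal_subgroup N.
pose theta i (x : perm_seq) : quot N := \pi_(quot N) (ins (Phi i x)).
have th i : hom_on A0 (theta i).
  split=> // x y Ax Ay; rewrite /theta PhiM; [|exact: (A0_alt s_alt)..].
  by rewrite insM ?[RHS]quot_piM //; apply: Phi_G0.
have /choice[nf hnf] : forall i, exists n, forall x, A0 x ->
    (forall k, (k < n)%N -> x k = 1) -> theta i x = 1.
  by move=> i; apply: (tails_killed k04 s_alt s_gen s_perfect (quot_finite N) (th i)).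
(* The bound [k0] makes the generators from the first factors vanish under truncation; the maximum
   serves all [d] families at once. *)
pose n := maxn k0 (\max_i nf i); exists n => x xn.
suff : (G0 `<=` [set w | G0 w /\ (N : set G) (ins (trunc n w))])%classic.
  move=> /(_ _ (subvalP x))[_]; rewrite trunc_id //.
  by have -> : ins (subval x) = x by apply: subval_inj; rewrite insE //; apply: subvalP.
have [G1 GM GV] := sG0.
have ins1 : ins 1 = 1 by apply: subval_inj; rewrite insE.
have h : hom_on G0 (fun w => ins (trunc n w)).
  by split=> // w w' Gw Gw'; rewrite truncM insM //; apply: trunc_G0.
apply: smallest_sub.
  split.
  - by split=> //; rewrite (hom_on1 h).
  - move=> w w' [Gw Nw] [Gw' Nw']; split; first exact: GM.
    by have [_ ->] := h => //; apply: NM.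
  - move=> w [Gw Nw]; split; first exact: GV.
    by rewrite (hom_onV h) //; apply: NV.
move=> w Sw; split; first exact: sub_gen_smallest.
case: Sw => [[i _ [y sy <-]]|[k /= kk [t _ <-]]].
  have Ay : A0 y by apply: sub_gen_smallest.
  have Aty := @trunc_A0 _ _ k04 s_alt s_gen s_perfect n y Ay.
  have -> : trunc n (Phi i y) = Phi i (trunc n y).
    by apply: cprodP => k; rewrite /trunc /Phi; case: ifP; rewrite ?morph1.
  have /quot_eqP : \pi_(quot N) (1 : G) = \pi_(quot N) (ins (Phi i (trunc n y))).
    apply/esym; apply: hnf => // k kn; rewrite /trunc (leq_trans kn) //.
    by rewrite /n leq_max (leq_bigmax i) orbT.
  by rewrite invg1 mul1g.
have -> : trunc n (@delta TT k t) = 1; last by rewrite ins1.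
apply: cprodP => j; rewrite /trunc; case: ifPn => //; rewrite -leqNgt => nj.
rewrite delta_out //; apply/eqP => kj; move: kk; rewrite kj ltnNge.
by rewrite (leq_trans (leq_maxl _ _) nj).
Qed.

Lemma frame_completion : exists G : groupType,
    finitely_generated G /\
    exists (f : C -> profinite_completion G) (g : profinite_completion G -> C),
      [/\ {morph f : x y / x * y}, cancel f g, cancel g f, continuous f & continuous g].
Proof.
exists G; split; first exact: subgroup_finitely_generated frame_gens_fin.
have fT k : finite_set [set: T k]%classic by exact: finite_finset.
exists (to_completion G0_delta G0_tail), (@of_completion TT fT _ sG0); split.
- exact: to_completionM.
- exact: to_completionK.
- exact: of_completionK.
- exact: continuous_to_completion.
- exact: continuous_of_completion.
Qed.

End Frame.

Theorem mainTheorem3 (d : nat) (T : nat -> finGroupType)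
    (Tgen : forall n : nat, (0 < n)%N ->
      exists phi : 'I_d -> {morphism 'Alt_('I_n) >-> T n},
        <<\bigcup_(i < d) (phi i @* 'Alt_('I_n))>> = [set: T n]) :
  exists G : groupType,
    finitely_generated G /\
    exists (f : cartesian_prod (fun n : nat => T n.+1) -> profinite_completion G)
           (g : profinite_completion G -> cartesian_prod (fun n : nat => T n.+1)),
      [/\ {morph f : x y / x * y}, cancel f g, cancel g f,
          continuous f & continuous g].
Proof.
have [k0 [s [k04 fs s_alt s_gen s_perfect]]] := perfect_family.
pose phi k := projT1 (cid (Tgen k.+1 isT)).
have phi_gen k : <<\bigcup_(i < d) (phi k i @* 'Alt_('I_k.+1))>> = [set: T k.+1].
  exact: (projT2 (cid (Tgen k.+1 isT))).
exact: (frame_completion phi_gen k04 fs s_alt s_gen s_perfect).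
Qed.
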